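(* Let $\Omega\subset\mathbb{R}^N$ be a bounded open connected set and let $\Theta$ be a Hausdorff continuous proper elliptic map on $\Omega$. Let $u\in \mathrm{USC}(\overline{\Omega})$ be $\Theta$-subharmonic in $\Omega$ and let $v\in\mathrm{LSC}(\overline{\Omega})$ be $\Theta$-superharmonic in $\Omega$. If $u\le v$ on $\partial\Omega$, then $u\le v$ in $\Omega$.
   Context: $\mathcal{S}(N)$ is the space of real symmetric $N\times N$ matrices with the usual partial order ($A\ge B$ iff $A-B$ is positive semidefinite); $\lambda_1(A)\le\dots\le\lambda_N(A)$ are the ordered eigenvalues of $A$ and $I$ is the identity. $\mathcal{Q}:=\{(s,P)\in\mathbb{R}\times\mathcal{S}(N): s\le 0,\ P\ge 0\}$. A map $\Theta$ from $\Omega$ to subsets of $\mathbb{R}\times\mathcal{S}(N)$ is a proper elliptic map if for each $x\in\Omega$, $\Theta(x)$ is closed, nonempty, not equal to $\mathbb{R}\times\mathcal{S}(N)$, and $\Theta(x)+\mathcal{Q}\subset\Theta(x)$. $\mathrm{USC}(E)$ (resp. $\mathrm{LSC}(E)$) denotes upper semicontinuous functions $E\to[-\infty,\infty)$ (resp. lower semicontinuous $E\to(-\infty,\infty]$). For $u$ defined near $x_0$, the upper test jets are $J^+_{x_0}u:=\{(\varphi(x_0),D^2\varphi(x_0)):\ \varphi$ is $C^2$ near $x_0$, $u\le\varphi$ near $x_0$, $u(x_0)=\varphi(x_0)\}$, and the lower test jets $J^-_{x_0}u$ are defined likewise with $u\ge\varphi$. A function $u\in\mathrm{USC}(\Omega)$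 is $\Theta$-subharmonic in $\Omega$ if $J^+_{x_0}u\subset\Theta(x_0)$ for every $x_0\in\Omega$; $v\in\mathrm{LSC}(\Omega)$ is $\Theta$-superharmonic in $\Omega$ if $J^-_{x_0}v\subset(\mathbb{R}\times\mathcal{S}(N))\setminus(\Theta(x_0))^\circ$ for every $x_0\in\Omega$ ($^\circ$ = interior). On $\mathbb{R}\times\mathcal{S}(N)$ use the norm $\|(r,A)\|=\max\{|r|,\max_i|\lambda_i(A)|\}$; for closed sets $\Phi,\Psi$ the Hausdorff distance is $d_{\mathcal H}(\Phi,\Psi)=\inf\{\varepsilon>0:\Phi\subset N_\varepsilon(\Psi),\ \Psi\subset N_\varepsilon(\Phi)\}\in[0,\infty]$, where $N_\varepsilon(\Phi)$ is the set of points at distance $<\varepsilon$ from some point of $\Phi$. $\Theta$ is Hausdorff continuous on $\Omega$ if for every $x\in\Omega$ and $\eta>0$ there is $\delta>0$ with $d_{\mathcal H}(\Theta(x),\Theta(y))<\eta$ for all $y\in\Omega$ with $|x-y|<\delta$. *)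

(* Defs.v *)
From HB Require Import structures.
From mathcomp Require Import all_boot all_order all_algebra.
From mathcomp Require Import all_classical all_reals all_analysis.
Set Implicit Arguments. Unset Strict Implicit. Unset Printing Implicit Defensive.
Import Order.TTheory GRing.Theory Num.Theory.
Import numFieldNormedType.Exports.
Local Open Scope classical_set_scope.
Local Open Scope ring_scope.

Section Defs.
Variables (R : realType) (N : nat).

Definition pt := 'rV[R]_N.

Definition euclid (x : pt) : R := Num.sqrt (\sum_(i < N) x ord0 i ^+ 2).

Definition evec (i : 'I_N) : pt := delta_mx ord0 i.

Definition partial (i : 'I_N) (f : pt -> R) : pt -> R := fun x => 'D_(evec i) f x.

Definition C2_near (phi : pt -> R) (x0 : pt) : Prop :=
  \forall x \near x0,
    (forall i, derivable phi x (evec i)) /\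
    (forall i j, derivable (partial j phi) x (evec i)) /\
    (forall i, {for x, continuous (partial i phi)}) /\
    (forall i j, {for x, continuous (partial i (partial j phi))}).

Definition hessian (phi : pt -> R) (x : pt) : 'M[R]_N :=
  \matrix_(i, j) partial i (partial j phi) x.

Definition symmetric (A : 'M[R]_N) : Prop := A^T = A.

Definition psd (A : 'M[R]_N) : Prop :=
  symmetric A /\ forall xi : 'rV[R]_N, 0 <= (xi *m A *m xi^T) ord0 ord0.

Definition jet := (R * 'M[R]_N)%type.
Definition jetspace : set jet := [set p | symmetric p.2].

(* max_i |lambda_i(A)|, the eigenvalues being those of A (real for A in S(N)) *)
Definition maxabseig (A : 'M[R]_N) : R :=
  sup [set `|a| | a in [set a : R | eigenvalue A a]].

Definition jnorm (p : jet) : R := Num.max `|p.1| (maxabseig p.2).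
Definition jdist (p q : jet) : R := jnorm (p.1 - q.1, p.2 - q.2).

Definition jclosed (Phi : set jet) : Prop :=
  Phi `<=` jetspace /\
  forall p, jetspace p ->
    (forall e : R, 0 < e -> exists2 q, Phi q & jdist p q < e) -> Phi p.

Definition jinterior (Phi : set jet) : set jet :=
  [set p | jetspace p /\ exists2 e : R, 0 < e &
     forall q, jetspace q -> jdist p q < e -> Phi q].

Definition Qcone : set jet := [set p | p.1 <= 0 /\ psd p.2].

Definition jsum (Phi Psi : set jet) : set jet :=
  [set p | exists2 a, Phi a & exists2 b, Psi b & p = (a.1 + b.1, a.2 + b.2)].

Definition proper_elliptic_map (Omega : set pt) (Theta : pt -> set jet) : Prop :=
  forall x, Omega x ->
    [/\ jclosed (Theta x), Theta x !=set0, Theta x <> jetspace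
      & jsum (Theta x) Qcone `<=` Theta x].

Definition jnbhd (e : R) (Phi : set jet) : set jet :=
  [set p | jetspace p /\ exists2 q, Phi q & jdist p q < e].

Definition hausdorff (Phi Psi : set jet) : \bar R :=
  ereal_inf [set e%:E | e in [set e : R | 0 < e /\
     Phi `<=` jnbhd e Psi /\ Psi `<=` jnbhd e Phi]].

Definition hausdorff_continuous (Omega : set pt) (Theta : pt -> set jet) : Prop :=
  forall x, Omega x -> forall eta : R, 0 < eta ->
    exists2 delta : R, 0 < delta &
      forall y, Omega y -> euclid (x - y) < delta ->
        (hausdorff (Theta x) (Theta y) < eta%:E)%E.

Definition USC (E : set pt) (u : pt -> \bar R) : Prop :=
  forall x, E x -> u x != +oo%E /\
    forall t : R, (u x < t%:E)%E -> \forall y \near x, E y -> (u y < t%:E)%E.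

Definition LSC (E : set pt) (v : pt -> \bar R) : Prop :=
  forall x, E x -> v x != -oo%E /\
    forall t : R, (t%:E < v x)%E -> \forall y \near x, E y -> (t%:E < v y)%E.

Definition upper_jets (u : pt -> \bar R) (x0 : pt) : set jet :=
  [set p | exists phi : pt -> R, [/\ C2_near phi x0,
      (\forall x \near x0, (u x <= (phi x)%:E)%E),
      u x0 = (phi x0)%:E & p = (phi x0, hessian phi x0)]].

Definition lower_jets (v : pt -> \bar R) (x0 : pt) : set jet :=
  [set p | exists phi : pt -> R, [/\ C2_near phi x0,
      (\forall x \near x0, ((phi x)%:E <= v x)%E),
      v x0 = (phi x0)%:E & p = (phi x0, hessian phi x0)]].

Definition subharmonic (Theta : pt -> set jet) (Omega : set pt) (u : pt -> \bar R) : Prop :=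
  USC Omega u /\ forall x0, Omega x0 -> upper_jets u x0 `<=` Theta x0.

Definition superharmonic (Theta : pt -> set jet) (Omega : set pt) (v : pt -> \bar R) : Prop :=
  LSC Omega v /\ forall x0, Omega x0 -> lower_jets v x0 `<=` ~` jinterior (Theta x0).

End Defs.

(* Main.v *)
(** If the conclusion fails, add a small multiple of [|x|^2 - const] to [u], which
    makes its jets strictly interior to [Theta], and pass to the sup-convolutions [f]
    of [u] and [g] of [-v] over the compact set [closure Omega].  They are semiconvex
    on the whole space, and a quadratic touching [f] (resp. [g]) from above translates
    to one touching [u] (resp. [-v]) from above at a nearby point.

    It remains to find, near the maximum of [f + g], quadratics touching [f] and [g]
    from above whose Hessians have sum at most a small multiple of [I].  Classically
    this follows from Alexandrov's theorem and Jensen's lemma; here a finitary argument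
    replaces both.  Let [Z] be the set of maximum points of [f + g - <p, .>] for small
    [p].  On [Z] both functions have two-sided quadratic bounds, so their gradients are
    Lipschitz there; since the gradients of [f + g] fill a ball of vectors [p], a fixed
    proportion of the cells of every fine grid meets [Z].  A density-increment argument
    on nested grids of cubes then produces a cube all of whose subcubes meet [Z] and on which
    the average slopes of the (extended) gradients are nearly constant.  On this cube
    the gradients are nearly affine, hence [f] and [g] are nearly quadratic around a
    point of [Z], where maximality bounds the sum of the Hessians. *)
Require Import Defs.
From HB Require Import structures.
From mathcomp Require Import all_boot all_order all_algebra.
From mathcomp Require Import all_classical all_reals all_analysis.
From mathcomp Require Import ring lra.
Set Implicit Arguments. Unset Strict Implicit. Unset Printing Implicit Defensive.
Import Order.TTheory GRing.Theory Num.Theory.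
Import numFieldNormedType.Exports.
Local Open Scope classical_set_scope.
Local Open Scope ring_scope.
(** * Inner product and norms *)

Lemma sum_le_const (R : realType) (I : finType) (F : I -> R) c :
  (forall i, F i <= c) -> \sum_i F i <= #|I|%:R * c.
Proof.
move=> h; apply: le_trans (ler_sum _ (fun i _ => h i)) _.
by rewrite sumr_const mulr_natl.
Qed.

Section Dot.
Variables (R : realType) (N : nat).
Implicit Types (x y z : 'rV[R]_N) (A B : 'M[R]_N).

Definition dot x y : R := \sum_i x ord0 i * y ord0 i.

Lemma dotC x y : dot x y = dot y x.
Proof. by apply: eq_bigr => i _; rewrite mulrC. Qed.

Lemma dotDl x y z : dot (x + y) z = dot x z + dot y z.
Proof. by rewrite /dot -big_split; apply: eq_bigr => i _; rewrite mxE mulrDl. Qed.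

Lemma dotZl a x y : dot (a *: x) y = a * dot x y.
Proof. by rewrite /dot mulr_sumr; apply: eq_bigr => i _; rewrite mxE mulrA. Qed.

Lemma dotNl x y : dot (- x) y = - dot x y.
Proof. by rewrite -scaleN1r dotZl mulN1r. Qed.

Lemma dot0l y : dot 0 y = 0.
Proof. by rewrite -(scale0r 0) dotZl mul0r. Qed.

Lemma dotDr x y z : dot x (y + z) = dot x y + dot x z.
Proof. by rewrite dotC dotDl !(dotC x). Qed.

Lemma dotZr a x y : dot x (a *: y) = a * dot x y.
Proof. by rewrite dotC dotZl dotC. Qed.

Lemma dotNr x y : dot x (- y) = - dot x y.
Proof. by rewrite dotC dotNl dotC. Qed.

Lemma dot0r x : dot x 0 = 0.
Proof. by rewrite dotC dot0l. Qed.

Definition dotE := (dotDl, dotDr, dotZl, dotZr, dotNl, dotNr, dot0l, dot0r).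

Lemma dot_mx A x y : dot (x *m A) y = (x *m A *m y^T) ord0 ord0.
Proof. by rewrite [RHS]mxE; apply: eq_bigr => i _; rewrite [y^T _ _]mxE. Qed.

Lemma dot_trmx A x y : dot (x *m A) y = dot (y *m A^T) x.
Proof.
rewrite !dot_mx -[LHS](mxE trmx_key (fun i j => (x *m A *m y^T) j i)).
by rewrite -[matrix_of_fun _ _]/((_)^T) !trmx_mul trmxK mulmxA.
Qed.

Lemma dot_delta x i : dot x (delta_mx ord0 i) = x ord0 i.
Proof.
rewrite /dot (bigD1 i) //= big1 ?addr0 ?mxE ?eqxx ?mulr1 // => j ji.
by rewrite mxE (negbTE ji) andbF mulr0.
Qed.

Lemma dotxx_ge0 x : 0 <= dot x x.
Proof. by apply: sumr_ge0 => i _; rewrite -expr2 sqr_ge0. Qed.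

Lemma dotxx_eq0 x : (dot x x == 0) = (x == 0).
Proof.
apply/eqP/eqP => [h|->]; last by rewrite dot0l.
apply/rowP => i; rewrite mxE; apply/eqP; rewrite -sqrf_eq0 expr2.
move/eqP: h; rewrite psumr_eq0 => [/allP/(_ i)|j _]; last by rewrite -expr2 sqr_ge0.
by rewrite mem_index_enum => /(_ isT).
Qed.

Lemma entry_le_norm A i j : `|A i j| <= `|A|.
Proof.
by rewrite [leRHS]/Num.norm /= mx_normrE; apply/bigmax_geP; right => /=; exists (i, j).
Qed.

Lemma coord_le_norm x i : `|x ord0 i| <= `|x|.
Proof.
by rewrite [leRHS]/Num.norm /= mx_normrE; apply/bigmax_geP; right => /=; exists (ord0, i).
Qed.

Lemma norm_le x (e : R) : 0 <= e -> (forall i, `|x ord0 i| <= e) -> `|x| <= e.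
Proof.
move=> e0 h; rewrite /Num.norm /= mx_normrE; apply: bigmax_le => // -[i j] _ /=.
by rewrite (ord1 i).
Qed.

Lemma norm_lt x (e : R) : 0 < e -> (forall i, `|x ord0 i| < e) -> `|x| < e.
Proof.
move=> e0 h; rewrite /Num.norm /= mx_normrE; apply/bigmax_ltP; split => // -[i j] _ /=.
by rewrite (ord1 i).
Qed.

Lemma sqr_norm_le_dot x : `|x| ^+ 2 <= dot x x.
Proof.
rewrite -[leRHS]sqr_sqrtr ?dotxx_ge0 // ler_pXn2r // ?nnegrE ?sqrtr_ge0 //.
apply: norm_le => [|i]; first exact: sqrtr_ge0.
rewrite -sqrtr_sqr ler_wsqrtr // /dot (bigD1 i) //= -expr2 lerDl.
by apply: sumr_ge0 => j _; rewrite -expr2 sqr_ge0.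
Qed.

Lemma dot_le x y : `|dot x y| <= N%:R * (`|x| * `|y|).
Proof.
apply: le_trans (ler_norm_sum _ _ _) _.
rewrite -[N in N%:R]card_ord; apply: sum_le_const => i.
by rewrite normrM; apply: ler_pM => //; exact: coord_le_norm.
Qed.

Lemma dotxx_le x : dot x x <= N%:R * `|x| ^+ 2.
Proof. by apply: le_trans (ler_norm _) _; rewrite expr2; exact: dot_le. Qed.

Lemma norm_mulmx_le A x (a : R) : (forall i j, `|A i j| <= a) ->
  `|x *m A| <= N%:R * (a * `|x|).
Proof.
move=> Aa; have [->|x0] := eqVneq x 0; first by rewrite mul0mx !normr0 !mulr0.
have [i0 _] : exists i : 'I_N, True.
  by apply/not_existsP => h; move/eqP: x0; apply; apply/rowP => i; case: (h i).
have a0 : 0 <= a by exact: le_trans (Aa i0 i0).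
apply: norm_le => [|j]; first by rewrite !mulr_ge0.
rewrite mxE; apply: le_trans (ler_norm_sum _ _ _) _.
rewrite -[N in N%:R]card_ord; apply: sum_le_const => i.
by rewrite normrM mulrC; apply: ler_pM => //; exact: coord_le_norm.
Qed.

Lemma dot_continuous (f g : 'rV[R]_N -> 'rV[R]_N) x :
  {for x, continuous f} -> {for x, continuous g} ->
  {for x, continuous (fun y => dot (f y) (g y))}.
Proof.
move=> cf cg; apply: (@cvg_big _ _ +%R 0 xpredT _ _ (nbhs x) (index_enum 'I_N)
  (fun i y => f y ord0 i * g y ord0 i)) => [|i _]; first exact: add_continuous.
have coord (h : 'rV[R]_N -> 'rV[R]_N) : {for x, continuous h} ->
    {for x, continuous (fun y => h y ord0 i)}.
  move=> ch; apply: (@continuous_comp _ _ _ h (fun M => M ord0 i)) => //.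
  exact: coord_continuous.
by apply: cvgM; exact: coord.
Qed.

(** Replaces the vanishing of a derivative at an extremum: testing with a small negative multiple of
    [a] makes the linear term beat the quadratic one. *)
Lemma dot_eq0_of_quadratic_bound (a : 'rV[R]_N) (c : R) : 0 <= c ->
  (forall d, - (c * dot d d) <= dot a d) -> a = 0.
Proof.
move=> c0 h; apply/eqP; rewrite -dotxx_eq0 eq_le dotxx_ge0 andbT.
have := h (- (c + 1)^-1 *: a); rewrite !dotE.
set t := (c + 1)^-1; set D := dot a a => hh.
have t0 : 0 < t by rewrite invr_gt0; lra.
have tc : t * (c + 1) = 1 by rewrite mulVf //; apply: lt0r_neq0; lra.
have : t * (t * D) <= 0 by nra.
by rewrite pmulr_rle0 // pmulr_rle0.
Qed.

End Dot.

Lemma near_norm (R : realType) (N : nat) (x : 'rV[R]_N) (P : 'rV[R]_N -> Prop) :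
  (\forall y \near x, P y) <->
  exists2 e : R, 0 < e & forall y, `|y - x| < e -> P y.
Proof.
split=> [/nbhs_normP[e /= e0 h]|[e e0 h]].
  by exists e => // y yx; apply: h => /=; rewrite distrC.
by apply/nbhs_normP; exists e => // y /=; rewrite distrC => /h.
Qed.
(** * Compactness and the largest eigenvalue *)

Lemma seq_cluster (T : topologicalType) (K : set T) (y : nat -> T) :
  compact K -> (forall n, K (y n)) ->
  exists2 z, K z & forall B, nbhs z B -> forall n0, exists2 n, (n0 <= n)%N & B (y n).
Proof.
move=> cK Ky; have yK : (y @ \oo) K by exists 0%N => // n _; exact: Ky.
have [z [Kz cz]] := cK _ _ yK.
exists z => // B zB n0.
have [|_ [[n /= n0n <-] Byn]] := cz [set y n | n in [set n | (n0 <= n)%N]] B _ zB.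
  by exists n0 => // n /= n0n; exists n.
by exists n.
Qed.

(** The superlevel sets of [h] at its values on [K] form a filter base, and any cluster point is a
    maximum. Only values of [h] serve as thresholds, so the codomain can be the reals or the
    extended reals. *)
Lemma usc_compact_max (T : topologicalType) (d : Order.disp_t) (S : orderType d)
    (K : set T) (h : T -> S) :
  compact K -> K !=set0 ->
  (forall z x, K z -> K x -> (h z < h x)%O ->
     \forall y \near z, K y -> (h y < h x)%O) ->
  exists2 x, K x & forall y, K y -> (h y <= h x)%O.
Proof.
move=> cK K0 usc.
pose F := filter_from K (fun x => [set y | K y /\ (h x <= h y)%O]).
have FF : ProperFilter F.
  apply: filter_from_proper => [|x Kx]; last by exists x.
  apply: filter_from_filter => // x y Kx Ky.
  have [xy|yx] := leP (h x) (h y).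
    by exists y => // z [Kz yz]; split; split=> //; exact: le_trans yz.
  by exists x => // z [Kz xz]; split; split=> //; exact: le_trans (ltW yx) xz.
have [|z [Kz cz]] := cK F FF.
  by case: K0 => x Kx; exists x => // y [].
exists z => // x Kx; rewrite leNgt; apply/negP => zx.
have [|w [[Kw xw] /(_ Kw)]] := cz [set y | K y /\ (h x <= h y)%O] _ _ (usc z x Kz Kx zx).
  by exists x.
by rewrite ltNge xw.
Qed.

Section Spectral.
Variables (R : realType) (N : nat).
Implicit Types (x y z : 'rV[R]_N) (E : 'M[R]_N).

Lemma qform_ge E x : - (N%:R * N%:R * `|E| * dot x x) <= dot (x *m E) x.
Proof.
have h1 := dot_le (x *m E) x; have h2 := @norm_mulmx_le R N E x `|E| (entry_le_norm E).
have h3 := sqr_norm_le_dot x.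
suff : `|dot (x *m E) x| <= N%:R * N%:R * `|E| * dot x x by rewrite ler_norml => /andP[].
apply: le_trans h1 _; apply: (@le_trans _ _ (N%:R * (N%:R * (`|E| * `|x|) * `|x|))).
  by rewrite ler_wpM2l // ler_wpM2r.
have -> : N%:R * (N%:R * (`|E| * `|x|) * `|x|) = N%:R * N%:R * `|E| * `|x| ^+ 2 :> R by ring.
by rewrite ler_wpM2l // !mulr_ge0.
Qed.

Lemma mulmxr_continuous E : continuous (fun x => x *m E).
Proof.
move=> x; apply/(@cvgrPdist_lt _ _ _ _ (nbhs_filter x)) => e e0; apply/near_norm.
have c0 : 0 < N%:R * `|E| + 1 by rewrite ltr_wpDl // mulr_ge0.
exists (e / (N%:R * `|E| + 1)) => [|y]; first exact: divr_gt0.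
rewrite ltr_pdivlMr // => yx; rewrite -mulmxBl distrC in yx *.
apply: le_lt_trans (norm_mulmx_le _ (entry_le_norm E)) _.
by apply: le_lt_trans yx; rewrite mulrA mulrC ler_wpM2l // lerDl.
Qed.

Lemma sphere_compact : compact [set x : 'rV[R]_N | dot x x = 1].
Proof.
apply: bounded_closed_compact.
  exists 1; split => // M M1 x /= x1; apply: le_trans (ltW M1).
  by rewrite -(@ler_pXn2r _ 2) ?nnegrE // expr1n -x1 sqr_norm_le_dot.
apply: (@closed_comp _ _ (fun x : 'rV[R]_N => dot x x) [set 1]); last exact: closed_eq.
by move=> x _; apply: dot_continuous; exact: cvg_id.
Qed.

Lemma eigenvalue_bound E a : eigenvalue E a -> `|a| <= N%:R * `|E|.
Proof.
move/eigenvalueP => [v vE v0].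
rewrite -(@ler_pM2r _ `|v|) ?normr_gt0 // -normrZ -vE -mulrA.
exact: norm_mulmx_le (entry_le_norm E).
Qed.

(** A maximiser of the quadratic form on the unit sphere is an eigenvector, so the largest value is
    an eigenvalue. This links [maxabseig] to the order on quadratic forms. *)
Lemma rayleigh_le_maxabseig E x : E^T = E ->
  dot (x *m E) x <= maxabseig E * dot x x.
Proof.
move=> sE; have [->|x0] := eqVneq x 0; first by rewrite mul0mx !dotE mulr0.
pose S := [set x : 'rV[R]_N | dot x x = 1].
pose nz y := (Num.sqrt (dot y y))^-1 *: y.
have Snz y : y != 0 -> S (nz y).
  move=> y0; rewrite /S /= !dotE mulrA -expr2 exprVn sqr_sqrtr ?dotxx_ge0 //.
  by rewrite mulVf // dotxx_eq0.
have qc (y : 'rV[R]_N) : {for y, continuous (fun y : 'rV[R]_N => dot (y *m E) y)}.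
  apply: dot_continuous; last exact: cvg_id.
  exact: mulmxr_continuous.
have [y /= Sy maxy] : exists2 y, S y & forall z, S z -> dot (z *m E) z <= dot (y *m E) y.
  apply: usc_compact_max sphere_compact _ _; first by exists (nz x); exact: Snz.
  move=> z w _ _ zw; have := qc z; move/cvgr_lt => /(_ _ zw); apply: filterS => t h _.
  exact: h.
set mu := dot (y *m E) y in maxy.
have qmu z : dot (z *m E) z <= mu * dot z z.
  have [->|z0] := eqVneq z 0; first by rewrite mul0mx !dotE mulr0.
  have := maxy _ (Snz _ z0); rewrite -scalemxAl !dotE mulrA -expr2 exprVn sqr_sqrtr ?dotxx_ge0 //.
  by rewrite mulrC ler_pdivrMr // lt_def dotxx_eq0 z0 dotxx_ge0.
have yE : y *m E = mu *: y.
  suff /eqP : 2 *: (mu *: y - y *m E) = 0.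
    by rewrite scaler_eq0 pnatr_eq0 /= subr_eq0 => /eqP.
  apply: (@dot_eq0_of_quadratic_bound _ _ _ (`|mu| + N%:R * N%:R * `|E|)).
    by rewrite addr_ge0 // !mulr_ge0.
  move=> d; have := qmu (y + d); rewrite mulmxDl !dotE (dot_trmx E d y) sE (dotC d y).
  rewrite (_ : dot y y = 1) // -/mu.
  have := qform_ge E d; have := ler_norm mu; have := dotxx_ge0 d.
  set D := dot d d; set q := dot (d *m E) d; set a := dot (y *m E) d; set b := dot y d.
  set C := N%:R * N%:R * `|E|; move=> *; nra.
have : `|mu| <= maxabseig E.
  apply: ub_le_sup; first by exists (N%:R * `|E|) => _ [a /eigenvalue_bound + <-].
  exists mu => //; apply/eigenvalueP; exists y => //.
  by rewrite -dotxx_eq0 (_ : dot y y = 1) // oner_eq0.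
move=> h; apply: le_trans (qmu x) _; rewrite ler_wpM2r ?dotxx_ge0 //.
exact: le_trans (ler_norm _) h.
Qed.

End Spectral.
(** * Quadratic test functions *)

Section Quadratic.
Variables (R : realType) (N : nat).
Implicit Types (x y p : 'rV[R]_N) (A : 'M[R]_N) (c : R).

Definition quad c p A x : R := c + dot p x + 2^-1 * dot (x *m A) x.

Lemma quad_shift c p A x d : A^T = A ->
  quad c p A (x + d) = quad c p A x + dot (p + x *m A) d + 2^-1 * dot (d *m A) d.
Proof.
move=> sA; rewrite /quad mulmxDl !dotE (dot_trmx A d x) sA.
have : (2^-1 : R) * 2 = 1 by rewrite mulVf // pnatr_eq0.
set a := 2^-1; set u := dot (x *m A) d; move=> a2.
rewrite (_ : dot p d + u = dot p d + (a * 2) * u); last by rewrite a2 mul1r.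
ring.
Qed.

Lemma derive_affine_quadratic (f : 'rV[R]_N -> R) x e (a b : R) :
  (forall h, f (h *: e + x) = f x + h * a + h ^+ 2 * b) ->
  derivable f x e /\ 'D_e f x = a.
Proof.
move=> fh.
have cv : h^-1 *: ((f \o shift x) (h *: e) - f x) @[h --> 0^'] --> a.
  apply: (@cvg_trans _ ((fun h : R => a + h * b) @ 0^')).
    apply: near_eq_cvg; near=> h.
    have h0 : h != 0 by near: h; exact: nbhs_dnbhs_neq.
    rewrite /= fh /GRing.scale /=; field.
    exact: h0.
  suff : (fun h : R => a + h * b) @ 0^' --> a + 0 * b by rewrite mul0r addr0.
  apply: cvgD; first exact: cvg_cst.
  apply: cvgM; last exact: cvg_cst.
  exact: cvg_within.
split; first by apply/cvg_ex; exists a.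
exact: cvg_lim cv.
Unshelve. all: by end_near. Qed.

Lemma partial_quad c p A i : A^T = A ->
  partial i (quad c p A) = fun x => (p + x *m A) ord0 i.
Proof.
move=> sA; apply/funext => x.
apply: (proj2 (@derive_affine_quadratic _ _ _ _ (2^-1 * A i i) _)) => h.
rewrite addrC quad_shift // -scalemxAl !dotE !dot_delta /evec.
by rewrite -rowE !mxE; ring.
Qed.

Lemma derivable_quad c p A i x : A^T = A -> derivable (quad c p A) x (evec R i).
Proof.
move=> sA.
apply: (proj1 (@derive_affine_quadratic _ _ _ ((p + x *m A) ord0 i) (2^-1 * A i i) _)) => h.
rewrite addrC quad_shift // -scalemxAl !dotE !dot_delta /evec.
by rewrite -rowE !mxE; ring.
Qed.

Lemma derive_affine p A i j x :
  derivable (fun x => (p + x *m A) ord0 j) x (evec R i) /\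
  'D_(evec R i) (fun x => (p + x *m A) ord0 j) x = A i j.
Proof.
apply: (@derive_affine_quadratic _ _ _ _ 0) => h.
by rewrite mulmxDl -scalemxAl /evec -rowE !mxE; ring.
Qed.

Lemma hessian_quad c p A x : A^T = A -> hessian (quad c p A) x = A.
Proof.
move=> sA; apply/matrixP => i j; rewrite mxE partial_quad // /partial.
by rewrite (derive_affine p A i j x).2.
Qed.

Lemma C2_quad c p A x : A^T = A -> C2_near (quad c p A) x.
Proof.
move=> sA; apply/near_norm; exists 1 => // y _; split=> [i|]; first exact: derivable_quad.
split=> [i j|]; first by rewrite partial_quad //; exact: (derive_affine p A i j y).1.
split=> [i|i j].
  rewrite partial_quad //.
  apply: (@continuous_comp _ _ _ (fun x => p + x *m A) (fun M => M ord0 i)).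
    apply: (@cvgD _ _ _ _ (nbhs_filter y)); last exact: mulmxr_continuous.
    exact: (@cvg_cst _ _ _ _ (nbhs_filter y)).
  exact: coord_continuous.
rewrite partial_quad // (_ : partial i _ = fun=> A i j).
  exact: (@cvg_cst _ _ _ _ (nbhs_filter y)).
by apply/funext => z; exact: (derive_affine p A i j z).2.
Qed.

End Quadratic.
(** * Averages over subdivided cubes *)

Section Grid.
Variables (R : realType) (N b : nat).
Local Notation V := 'rV[R]_N.
Local Notation cells := {ffun 'I_N -> 'I_b.+1}.
Local Notation B := (b.+1%:R : R).

Definition vecn (k : 'I_N -> nat) : V := \row_i (k i)%:R.
Definition coords (q : cells) : 'I_N -> nat := fun i => q i.
Definition upd (k : 'I_N -> nat) j r : 'I_N -> nat := fun i => if i == j then r else k i.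
Definition avg (F : cells -> R) : R := (b.+1 ^ N)%:R^-1 * \sum_q F q.

Lemma B_gt0 : 0 < B. Proof. by rewrite ltr0n. Qed.
Lemma B_neq0 : B != 0. Proof. by rewrite pnatr_eq0. Qed.

Lemma ncells_gt0 : 0 < (b.+1 ^ N)%:R :> R.
Proof. by rewrite ltr0n expn_gt0. Qed.

Lemma avg_cst c : avg (fun=> c) = c.
Proof.
rewrite /avg sumr_const card_ffun !card_ord -(mulr_natl c) mulrA mulVf ?mul1r //.
Qed.

Lemma avgD F G : avg (fun q => F q + G q) = avg F + avg G.
Proof. by rewrite /avg big_split mulrDr. Qed.

Lemma avgZ c F : avg (fun q => c * F q) = c * avg F.
Proof. by rewrite /avg -mulr_sumr mulrCA. Qed.

Lemma avgB F G : avg (fun q => F q - G q) = avg F - avg G.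
Proof. by rewrite /avg big_split -mulrBr sumrN. Qed.

Lemma avg_sum (I : finType) (F : I -> cells -> R) :
  avg (fun q => \sum_i F i q) = \sum_i avg (F i).
Proof. by rewrite /avg exchange_big mulr_sumr. Qed.

Lemma avg_le F G : (forall q, F q <= G q) -> avg F <= avg G.
Proof. by move=> FG; rewrite ler_wpM2l ?invr_ge0 // ler_sum. Qed.

Lemma avg_dist F c e : (forall q, `|F q - c| <= e) -> `|avg F - c| <= e.
Proof.
move=> Fc; rewrite ler_norml; apply/andP; split.
  rewrite -(avg_cst (- e)) -{1}(avg_cst c) -avgB; apply: avg_le => q.
  by have := Fc q; rewrite ler_norml => /andP[].
rewrite -(avg_cst e) -{1}(avg_cst c) -avgB; apply: avg_le => q.
by have := Fc q; rewrite ler_norml => /andP[].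
Qed.

Lemma term_le_avg F q e : (forall q, 0 <= F q) -> avg F <= e -> F q <= (b.+1 ^ N)%:R * e.
Proof.
move=> F0; rewrite /avg mulrC ler_pdivrMr ?ncells_gt0 // (mulrC e); apply: le_trans.
by rewrite (bigD1 q) //= lerDl sumr_ge0.
Qed.


(** Prepares telescoping: shifting the cells cyclically in direction [j] (addition in ['I_b.+1] is
    modulo [b.+1]) preserves the average, and averaging over all shifts sums each column. *)
Lemma avg_line (psi : ('I_N -> nat) -> R) j :
  avg (fun q => psi (coords q)) =
  B^-1 * avg (fun q => \sum_(r < b.+1) psi (upd (coords q) j r)).
Proof.
pose sh (c : 'I_b.+1) (q : cells) : cells := [ffun i => if i == j then q i + c else q i].
have shK c : cancel (sh c) (sh (- c)).
  by move=> q; apply/ffunP => i; rewrite !ffunE; case: eqP => // _; rewrite addrK.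
have shE c q : coords (sh c q) = upd (coords q) j (q j + c)%R.
  by apply/funext => i; rewrite /coords /upd ffunE; case: eqP => // ->.
rewrite /avg mulrCA; congr (_ * _).
apply: (mulfI B_neq0); rewrite mulrA divff ?mul1r ?B_neq0 //.
transitivity (\sum_(c < b.+1) \sum_q psi (coords (sh c q))).
  rewrite [RHS](eq_bigr (fun=> \sum_q psi (coords q))) => [|c _].
    by rewrite sumr_const card_ord mulr_natl.
  by rewrite [RHS](reindex_inj (can_inj (shK c))).
rewrite exchange_big; apply: eq_bigr => q _.
rewrite [RHS](reindex_inj (addrI (q j))); apply: eq_bigr => c _.
by rewrite shE.
Qed.

Lemma telescope_upd (psi : ('I_N -> nat) -> R) k j n :
  \sum_(r < n) (psi (upd k j r.+1) - psi (upd k j r)) = psi (upd k j n) - psi (upd k j 0).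
Proof.
by rewrite -(big_mkord xpredT (fun r => psi (upd k j r.+1) - psi (upd k j r))) telescope_sumr.
Qed.

Lemma updK k j r r' : upd (upd k j r) j r' = upd k j r'.
Proof. by apply/funext => i; rewrite /upd; case: eqP. Qed.

Lemma upd_self k j : upd k j (k j) = k.
Proof. by apply/funext => i; rewrite /upd; case: eqP => // ->. Qed.

Lemma vecn_upd k j r n : vecn (upd k j (r + n)) = vecn (upd k j r) + n%:R *: evec R j.
Proof.
apply/rowP => i; rewrite !mxE /upd eqxx /=; case: eqP => _.
  by rewrite mulr1 natrD.
by rewrite mulr0 addr0.
Qed.

Lemma vecn_updS k j r : vecn (upd k j r.+1) = vecn (upd k j r) + evec R j.
Proof. by rewrite -[r.+1]addn1 vecn_upd scale1r. Qed.

Lemma norm_vecn_le (k : 'I_N -> nat) n : (forall i, k i <= n)%N -> `|vecn k| <= n%:R.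
Proof. by move=> kn; apply: norm_le => // i; rewrite mxE ger0_norm // ler_nat. Qed.

Definition child (o : V) (s : R) (q : cells) : V := o + (s / B) *: vecn (coords q).

Section Slope.
Variable G : V -> R.

(* Average of [G] over the corners of the depth-[t] subcubes adjacent to the
   facet of the cube orthogonal to [e_j]; each corner is counted once per cell
   in the column above it, so that the average can range over all of [cells]. *)
Fixpoint face j t (o : V) (s : R) : R :=
  if t is t'.+1 then
    avg (fun q => face j t' (o + (s / B) *: vecn (upd (coords q) j 0)) (s / B))
  else G o.

(** Discrete analogue of the mean over the cube of a partial derivative. *)
Definition slope j t o s := (face j t (o + s *: evec R j) s - face j t o s) / s.

(** Along each column in direction [j] the upper facet of a subcube is the lower facet of the next,
    so the slopes telescope to the two outer facets. The recursive form of [face] makes this an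
    exact identity, as the energy argument requires. *)
Lemma slope_avg j t o s : 0 < s ->
  slope j t.+1 o s = avg (fun q => slope j t (child o s q) (s / B)).
Proof.
move=> s0; set h := s / B.
have h0 : h != 0 by rewrite mulf_neq0 ?invr_eq0 ?B_neq0 // lt0r_neq0.
have sE : s = B * h by rewrite mulrC divfK ?B_neq0.
pose psi k := face j t (o + h *: vecn k) h.
pose phi k := (psi (upd k j (k j).+1) - psi k) / h.
rewrite (_ : (fun q => _) = fun q => phi (coords q)); last first.
  apply/funext => q; rewrite /slope /phi /psi /child -/h -addrA -scalerDr.
  by rewrite vecn_updS upd_self.
rewrite (avg_line phi j).
rewrite (_ : (fun q => _) = fun q => h^-1 *
    (psi (upd (coords q) j b.+1) - psi (upd (coords q) j 0))); last first.
  apply/funext => q; rewrite -telescope_upd mulr_sumr; apply: eq_bigr => r _.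
  by rewrite /phi updK {2}/upd eqxx mulrC.
rewrite avgZ avgB /slope /= -/h {2}sE invfM.
rewrite (_ : (fun q => face j t (o + s *: _ + _) h) = fun q => psi (upd (coords q) j b.+1)).
  by ring.
apply/funext => q; rewrite /psi -[b.+1]add0n vecn_upd scalerDr scalerA (mulrC h) -sE.
by rewrite -addrA (addrC (s *: _)).
Qed.

Variable L : R.
Hypothesis lipG : forall x y, `|G x - G y| <= L * `|x - y|.

Lemma face_lip j t o o' s : `|face j t o s - face j t o' s| <= L * `|o - o'|.
Proof.
elim: t o o' s => [|t IH] o o' s /=; first exact: lipG.
rewrite -avgB -[X in `|X|]subr0; apply: avg_dist => q; rewrite subr0.
by apply: le_trans (IH _ _ _) _; rewrite opprD addrACA subrr addr0.
Qed.

Hypothesis L0 : 0 <= L.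

Lemma face_near j t o s : 0 <= s -> `|face j t o s - G o| <= L * s.
Proof.
elim: t o s => [|t IH] o s s0 /=; first by rewrite subrr normr0 mulr_ge0.
apply: avg_dist => q; set h := s / B.
have h0 : 0 <= h by rewrite divr_ge0.
have sE : s = B * h by rewrite mulrC divfK ?B_neq0.
set o' := o + _.
apply: le_trans (ler_distD (G o') _ _) _.
apply: le_trans (lerD (IH o' h h0) (lipG o' o)) _.
rewrite -mulrDr ler_wpM2l // /o' (addrC o) addrK normrZ (ger0_norm h0) sE -natr1 mulrDl mul1r.
rewrite addrC lerD2r mulrC ler_wpM2r // norm_vecn_le // => i; rewrite /upd.
by case: ifP => // _; rewrite -ltnS /coords ltn_ord.
Qed.

Lemma slope_le j t o s : 0 < s -> `|slope j t o s| <= L.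
Proof.
move=> s0; rewrite /slope normrM normfV (gtr0_norm s0) ler_pdivrMr //.
apply: le_trans (face_lip _ _ _ _ _) _; rewrite ler_wpM2l // (addrC o) addrK normrZ.
rewrite (gtr0_norm s0) ler_piMr ?(ltW s0) //; apply: norm_le => // i.
by rewrite mxE; case: (_ && _); rewrite ?normr1 ?normr0.
Qed.

(** Slopes along a row telescope to a difference of facet averages; replacing these by the corner
    values of [G] costs [L * h] at each end. *)
Lemma row_increment j t (k : 'I_N -> nat) o h n A tau : 0 < h -> 0 <= tau ->
  (forall r, (r < n)%N -> `|slope j t (o + h *: vecn (upd k j r)) h - A| <= tau) ->
  `|G (o + h *: vecn (upd k j n)) - G (o + h *: vecn (upd k j 0)) - n%:R * h * A|
    <= n%:R * h * tau + 2 * L * h.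
Proof.
move=> h0 tau0 sl; pose psi k := face j t (o + h *: vecn k) h.
have tel : psi (upd k j n) - psi (upd k j 0)
    = h * \sum_(r < n) slope j t (o + h *: vecn (upd k j r)) h.
  rewrite -telescope_upd mulr_sumr; apply: eq_bigr => r _.
  rewrite /slope mulrC divfK ?lt0r_neq0 // /psi.
  by rewrite vecn_updS scalerDr addrA.
have d1 : `|psi (upd k j n) - psi (upd k j 0) - n%:R * h * A| <= n%:R * h * tau.
  rewrite tel (_ : _ - _ = h * \sum_(r < n) (slope j t (o + h *: vecn (upd k j r)) h - A)).
    rewrite normrM (gtr0_norm h0) (mulrC n%:R) -mulrA ler_wpM2l ?(ltW h0) //.
    apply: le_trans (ler_norm_sum _ _ _) _.
    rewrite -[n in n%:R]card_ord; apply: sum_le_const => r; exact: sl.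
  by rewrite sumrB sumr_const card_ord -(mulr_natl A); ring.
have d2 := face_near j t (o + h *: vecn (upd k j n)) (ltW h0).
have d3 := face_near j t (o + h *: vecn (upd k j 0)) (ltW h0).
move: d1 d2 d3; rewrite -!/(psi _) !ler_norml.
set g1 := G _; set g2 := G _; move: (psi _) (psi _) => p1 p2.
by move=> /andP[? ?] /andP[? ?] /andP[? ?]; apply/andP; split; lra.
Qed.

End Slope.
End Grid.
(** * Density increment *)

Section Density.
Variables (R : realType) (N b : nat) (Z : set 'rV[R]_N).
Local Notation V := 'rV[R]_N.
Local Notation cells := {ffun 'I_N -> 'I_b.+1}.
Local Notation B := (b.+1%:R : R).
Local Notation child := (@child R N b).
Local Notation avg := (@avg R N b).

(** Half-open, so that the subcubes of a cube partition it. *)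
Definition incube (o : V) (s : R) (z : V) : Prop :=
  forall i, o ord0 i <= z ord0 i < o ord0 i + s.

(* Proportion of the depth-[t] subcubes that meet [Z]. *)
Fixpoint cdens t (o : V) (s : R) : R :=
  if t is t'.+1 then avg (fun q => cdens t' (child o s q) (s / B))
  else `[< exists2 z, Z z & incube o s z >]%:R.

Lemma cdens_ge0 t o s : 0 <= cdens t o s.
Proof.
elim: t o s => [|t IH] o s //=; rewrite -(avg_cst N b (0 : R)).
by apply: avg_le => q; exact: IH.
Qed.

Lemma cdens_le1 t o s : cdens t o s <= 1.
Proof.
elim: t o s => [|t IH] o s /=; first by rewrite lern1 leq_b1.
by rewrite -(avg_cst N b (1 : R)); apply: avg_le => q; exact: IH.
Qed.

Lemma incube_child o s q z : 0 < s -> incube (child o s q) (s / B) z -> incube o s z.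
Proof.
move=> s0 h i; move/andP: (h i); rewrite !mxE => -[h1 h2].
have hh : 0 < s / B by rewrite divr_gt0 // B_gt0.
have sE : s = B * (s / B) by rewrite mulrC divfK ?B_neq0.
have q0 : 0 <= (coords q i)%:R :> R by [].
have qB : (coords q i)%:R <= B - 1 by rewrite lerBrDr natr1 ler_nat /coords ltn_ord.
move: h1 h2 sE hh; set h' := s / B; move: (coords q i)%:R q0 qB => k *.
by apply/andP; split; nra.
Qed.

Lemma incube_split o s z : 0 < s -> incube o s z ->
  exists q, incube (child o s q) (s / B) z.
Proof.
move=> s0 oz; set h := s / B.
have h0 : 0 < h by rewrite divr_gt0 // B_gt0.
have sE : s = B * h by rewrite mulrC divfK ?B_neq0.
have x0 i : 0 <= (z ord0 i - o ord0 i) / h.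
  by rewrite divr_ge0 ?(ltW h0) // subr_ge0; case/andP: (oz i).
have tB i : (Num.truncn ((z ord0 i - o ord0 i) / h) < b.+1)%N.
  rewrite -(ltr_nat R); have /andP[h1 _] := truncn_itv (x0 i).
  apply: le_lt_trans h1 _; rewrite ltr_pdivrMr // -sE ltrBlDl.
  by case/andP: (oz i).
exists [ffun i => Ordinal (tB i)] => i; rewrite !mxE /coords ffunE /= -/h.
have := truncn_itv (x0 i); rewrite ler_pdivlMr // ltr_pdivrMr // -natr1.
by move=> /andP[h1 h2]; apply/andP; split; lra.
Qed.

Lemma cdens_contact t o s : 0 < s -> 0 < cdens t o s -> exists2 z, Z z & incube o s z.
Proof.
elim: t o s => [|t IH] o s s0 /=; first by rewrite ltr0n lt0b => /asboolP.
move=> h; have [q hq] : exists q, 0 < cdens t (child o s q) (s / B).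
  apply/not_existsP => hn; move: h; rewrite ltNge -(avg_cst N b (0 : R)) => /negP; apply.
  by apply: avg_le => q; rewrite leNgt; apply/negP => /hn.
have [|z Zz oz] := IH _ _ _ hq; first by rewrite divr_gt0 // B_gt0.
by exists z => //; exact: incube_child oz.
Qed.

(** The separation leaves at most one point of [P] in each subcube of depth [t], so the subcubes
    meeting [Z] are at least as many as the points. The induction distributes [P] among the
    children. *)
Lemma size_le_cdens t o s (P : seq V) : 0 < s -> uniq P ->
  (forall z, z \in P -> Z z /\ incube o s z) ->
  (forall z z', z \in P -> z' \in P ->
     (forall i, `|z ord0 i - z' ord0 i| < s / B ^+ t) -> z = z') ->
  (size P)%:R <= cdens t o s * (b.+1 ^ N)%:R ^+ t.
Proof.
elim: t o s P => [|t IH] o s P s0 uP PZ sepP /=.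
  rewrite expr0 mulr1 ler_nat; case: P uP PZ sepP => // z P uP PZ sepP.
  rewrite (_ : `[< _ >]) /=; last first.
    by apply/asboolP; exists z; apply PZ; rewrite mem_head.
  case: P uP PZ sepP => //= z' P /andP[+ _] PZ sepP.
  rewrite (sepP z z') ?mem_head ?inE ?eqxx ?orbT // => i.
  have /andP[] := (PZ z (mem_head _ _)).2 i.
  have /andP[] : o ord0 i <= z' ord0 i < o ord0 i + s.
    by apply: (PZ z' _).2; rewrite !inE eqxx orbT.
  by rewrite expr0 divr1 ltr_norml => *; apply/andP; split; lra.
have sB : 0 < s / B by rewrite divr_gt0 // B_gt0.
pose Pq (q : cells) := [seq z <- P | `[< incube (child o s q) (s / B) z >]].
have sP : (size P <= \sum_q size (Pq q))%N.
  rewrite -sum1_size (eq_bigr (fun q => (\sum_(z <- P) `[< incube (child o s q) (s / B)%R z >])%N)).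
    rewrite exchange_big /= big_seq [leqRHS]big_seq; apply: leq_sum => z zP.
    have [q hq] := incube_split s0 (PZ z zP).2.
    by rewrite (bigD1 q) //= (asboolT hq).
  by move=> q _; rewrite size_filter -sum1_count big_mkcond; apply: eq_bigr => z _; case: asboolP.
apply: (@le_trans _ _ (\sum_q (size (Pq q))%:R)); first by rewrite -natr_sum ler_nat.
have -> : avg (fun q => cdens t (child o s q) (s / B)) * (b.+1 ^ N)%:R ^+ t.+1 =
    \sum_q (cdens t (child o s q) (s / B) * (b.+1 ^ N)%:R ^+ t).
  rewrite /avg exprS -mulr_suml; set S := \sum_q _; set n := (b.+1 ^ N)%:R.
  have n0 : n != 0 by apply: lt0r_neq0; exact: ncells_gt0.
  by rewrite -[RHS]mul1r -(mulVf n0); ring.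
apply: ler_sum => q _; apply: IH => //; first exact: filter_uniq.
  move=> z; rewrite mem_filter => /andP[/asboolP hz zP].
  by split => //; exact: (PZ z zP).1.
move=> z z'; rewrite !mem_filter => /andP[_ zP] /andP[_ z'P] zz'.
apply: sepP => // i; apply: lt_le_trans (zz' i) _.
by rewrite exprS invfM mulrA.
Qed.

Section Energy.
Variables (I : finType) (G : I -> V -> R) (L : R).
Hypothesis L0 : 0 <= L.
Hypothesis lipG : forall i x y, `|G i x - G i y| <= L * `|x - y|.
Variable kappa : R.
Hypothesis kappa0 : 0 < kappa.

Definition slopes (ij : I * 'I_N) t o s := slope b (G ij.1) ij.2 t o s.

(* Both terms are averages over the children up to the variance of the slopes, so
   the energy does not decrease on average; where no child increases it noticeably,
   the slopes of all children agree.  [kappa] is small enough for a cube of energy at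
   least the initial contact density to need contact points. *)
Definition energy t o s := cdens t o s + kappa * \sum_ij slopes ij t o s ^+ 2.

Lemma energy_le t o s : 0 < s -> energy t o s <= 1 + kappa * (#|{: I * 'I_N}|%:R * L ^+ 2).
Proof.
move=> s0; rewrite lerD ?cdens_le1 // ler_wpM2l ?(ltW kappa0) //.
apply: sum_le_const => ij; rewrite -real_normK ?num_real // ler_pXn2r ?nnegrE //.
exact: slope_le.
Qed.

Lemma avg_variance (F : cells -> R) :
  avg (fun q => F q ^+ 2) - avg F ^+ 2 = avg (fun q => (F q - avg F) ^+ 2).
Proof.
set m := avg F.
rewrite (_ : (fun q => (F q - m) ^+ 2) = fun q => F q ^+ 2 + ((- (2 * m)) * F q + m ^+ 2)).
  by rewrite !avgD avgZ avg_cst -/m; ring.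
by apply/funext => q; ring.
Qed.

(** The contact densities cancel by the recursion of [cdens], and by [slope_avg] the squares leave
    the variances of the slopes. *)
Lemma energy_avg t o s : 0 < s ->
  avg (fun q => energy t (child o s q) (s / B)) - energy t.+1 o s =
  kappa * \sum_ij avg (fun q => (slopes ij t (child o s q) (s / B) - slopes ij t.+1 o s) ^+ 2).
Proof.
move=> s0; rewrite /energy avgD avgZ avg_sum /= opprD addrACA subrr add0r -mulrBr -sumrB.
congr (_ * _); apply: eq_bigr => ij _; rewrite /slopes slope_avg //.
exact: avg_variance.
Qed.

Lemma energy_le_avg t o s : 0 < s ->
  energy t.+1 o s <= avg (fun q => energy t (child o s q) (s / B)).
Proof.
move=> s0; rewrite -subr_ge0 energy_avg // mulr_ge0 ?(ltW kappa0) // sumr_ge0 // => ij _.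
by rewrite -(avg_cst N b (0 : R)); apply: avg_le => q; exact: sqr_ge0.
Qed.

(** Density increment: as long as some child gains more than [eta], pass to it. The bound [M] allows
    fewer than [t] such moves, so a stable cube occurs before the depth runs out. *)
Lemma energy_stable t o s eta e0 s1 M : 0 <= eta ->
  (forall t o s, 0 < s -> energy t o s <= M) ->
  0 < s -> s <= s1 -> e0 <= energy t o s -> M < energy t o s + t%:R * eta ->
  exists t' o' s', [/\ 0 < s', s' <= s1, e0 <= energy t'.+1 o' s' &
    forall q, energy t' (child o' s' q) (s' / B) <= energy t'.+1 o' s' + eta].
Proof.
move=> eta0 eM; elim: t o s => [|t IH] o s s0 ss1 e0e.
  by rewrite mul0r addr0 ltNge eM.
move=> big.
have [st|] := pselect (forall q, energy t (child o s q) (s / B) <= energy t.+1 o s + eta).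
  by exists t, o, s.
move/existsNP => [q /negP]; rewrite -ltNge => hq.
have sB : 0 < s / B by rewrite divr_gt0 // B_gt0.
apply: (IH (child o s q) (s / B)) => //.
- by apply: le_trans ss1; rewrite ler_pdivrMr ?B_gt0 // ler_peMr ?(ltW s0) // ler1n.
- by apply: le_trans e0e _; apply: le_trans (ltW hq); rewrite lerDl.
- by move: big hq; rewrite -natr1 mulrDl mul1r; lra.
Qed.

(** Some child has at least the average energy, so cubes can be made small without losing any. *)
Lemma energy_descend n t o s : 0 < s ->
  exists o', energy (n + t) o s <= energy t o' (s / B ^+ n).
Proof.
elim: n o s => [|n IH] o s s0; first by exists o; rewrite expr0 divr1.
have [q hq] : exists q, energy (n + t).+1 o s <= energy (n + t) (child o s q) (s / B).
  apply/not_existsP => hn.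
  have h : 0 < avg (fun q => energy (n + t).+1 o s - energy (n + t) (child o s q) (s / B)).
    rewrite mulr_gt0 ?invr_gt0 ?ncells_gt0 //.
    have pos q : 0 < energy (n + t).+1 o s - energy (n + t) (child o s q) (s / B).
      by rewrite subr_gt0 ltNge; apply/negP => /hn.
    rewrite (bigD1 [ffun=> ord0]) //= ltr_pwDl // sumr_ge0 // => q _; exact/ltW.
  by move: h; rewrite avgB avg_cst subr_gt0 ltNge energy_le_avg.
have [|o' ho'] := IH (child o s q) (s / B); first by rewrite divr_gt0 // B_gt0.
exists o'; rewrite exprS invfM mulrA; exact: le_trans hq ho'.
Qed.

End Energy.
End Density.

(** In a stable cube no child exceeds the parent by more than [eta], while the children average at
    least the energy of the parent; hence no child falls far below, and the slope variances are
    small. The depth [T] is fixed before the cube, to be combined with a density bound valid at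
    every depth. *)
Lemma good_cube (R : realType) (N b : nat) (Z : set 'rV[R]_N) (I : finType)
    (G : I -> 'rV[R]_N -> R) (L tau c0 s0 s1 : R) :
  (0 < b)%N -> 0 <= L -> (forall i x y, `|G i x - G i y| <= L * `|x - y|) ->
  0 < tau -> 0 < c0 -> 0 < s0 -> 0 < s1 ->
  exists T, forall o, c0 <= cdens b Z T.+1 o s0 ->
  exists t w s', [/\ 0 < s', s' <= s1,
    forall q : {ffun 'I_N -> 'I_b.+1},
      exists2 z, Z z & incube (child w s' q) (s' / b.+1%:R) z &
    forall i j (q : {ffun 'I_N -> 'I_b.+1}), `|slope b (G i) j t (child w s' q) (s' / b.+1%:R)
                    - slope b (G i) j t.+1 w s'| <= tau].
Proof.
move=> b0 L0 lipG tau0 c00 s00 s10.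
pose m : R := #|{: I * 'I_N}|%:R * L ^+ 2.
have m0 : 0 <= m by rewrite mulr_ge0 // sqr_ge0.
(* The slope part of any energy is then at most [c0 / 2], so a larger energy requires contact
   points. *)
pose kappa := c0 / 2 / (m + 1).
have m1 : 0 < m + 1 by rewrite ltr_wpDl.
have kappa0 : 0 < kappa by rewrite !divr_gt0.
have km : kappa * m <= c0 / 2.
  rewrite /kappa -mulrA ler_piMr ?divr_ge0 ?(ltW c00) // mulrC ler_pdivrMr // mul1r.
  by rewrite lerDl.
pose n : R := (b.+1 ^ N)%:R.
have n0 : 0 < n := ncells_gt0 R N b.
(* A nonnegative quantity of mean at most [eta] over [n] cells is at most [n * eta] on each; the two
   bounds serve the contact density and the slope deviations. *)
pose eta := Num.min (c0 / 4) (kappa * tau ^+ 2) / n.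
have eta0 : 0 < eta by rewrite divr_gt0 // lt_min !divr_gt0 //= mulr_gt0 // exprn_gt0.
have neta : n * eta = Num.min (c0 / 4) (kappa * tau ^+ 2).
  by rewrite mulrC divfK // lt0r_neq0.
pose B : R := b.+1%:R.
have B2 : 2 <= B by rewrite ler_nat.
have [n1 hn1] : exists n1, s0 / B ^+ n1 <= s1.
  exists (Num.truncn (s0 / s1)).+1; set k := (_).+1.
  rewrite ler_pdivrMr ?exprn_gt0 // ?(lt_le_trans _ B2) // mulrC -ler_pdivrMr //.
  have h : s0 / s1 < k%:R.
    by have /andP[_] := truncn_itv (ltW (divr_gt0 s00 s10)).
  apply: le_trans (ltW h) _; apply: (@le_trans _ _ (2 ^+ k)).
    by rewrite -natrX ler_nat ltnW // ltn_expl.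
  by rewrite ler_pXn2r ?nnegrE // (le_trans _ B2).
have [n2 hn2] : exists n2, 2 + c0 < n2%:R * eta.
  exists (Num.truncn ((2 + c0) / eta)).+1; rewrite -ltr_pdivrMr //.
  have p : 0 <= (2 + c0) / eta by rewrite divr_ge0 ?(ltW eta0) //; lra.
  by have /andP[_] := truncn_itv p.
(* The first [n1.+1] levels bring the side below [s1]; the other [n2] leave room for the energy
   increments. *)
exists (n1 + n2)%N => o hc.
pose En := energy b Z G kappa.
have eM t' w s' : 0 < s' -> En t' w s' <= 2 + c0.
  move=> s'0; have := @energy_le R N b Z I G L L0 lipG kappa kappa0 t' w s' s'0.
  rewrite -/m -/En; lra.
have [|o1 ho1] := @energy_descend R N b Z I G kappa kappa0 n1.+1 n2 o s0; first by [].
have e1 : c0 <= En n2 o1 (s0 / B ^+ n1.+1).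
  apply: le_trans hc _; apply: le_trans ho1; rewrite addSn lerDl.
  by rewrite mulr_ge0 ?(ltW kappa0) // sumr_ge0 // => ij _; exact: sqr_ge0.
have B0 : 0 < B by rewrite (lt_le_trans _ B2).
have s'0 : 0 < s0 / B ^+ n1.+1 by rewrite divr_gt0 // exprn_gt0.
have s's1 : s0 / B ^+ n1.+1 <= s1.
  apply: le_trans hn1; rewrite exprS invfM mulrCA ler_piMl ?divr_ge0 ?exprn_ge0 ?(ltW s00) ?(ltW B0) //.
  by rewrite invf_le1 // (le_trans _ B2) // ler1n.
have big : 2 + c0 < En n2 o1 (s0 / B ^+ n1.+1) + n2%:R * eta.
  by apply: lt_le_trans hn2 _; rewrite lerDr (le_trans (ltW c00)).
have [t [w [s' [s'pos s'le e' st]]]] :=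
  energy_stable (ltW eta0) eM s'0 s's1 e1 big.
exists t, w, s'; split=> // [q|i j q].
  have hB : 0 < s' / B by rewrite divr_gt0.
  apply: (@cdens_contact R N b Z t) => //.
  (* Without contact points the child would have energy at most [c0 / 2], below the level
     [3 * c0 / 4] that stability guarantees. *)
  rewrite lt_neqAle cdens_ge0 andbT; apply/eqP => c0E.
  have low : energy b Z G kappa t (child w s' q) (s' / B) <= c0 / 2.
    rewrite /energy -c0E add0r; apply: le_trans km; rewrite ler_wpM2l ?(ltW kappa0) //.
    apply: sum_le_const => ij; rewrite -real_normK ?num_real // ler_pXn2r ?nnegrE //.
    exact: slope_le.
  have dev (q' : {ffun 'I_N -> 'I_b.+1}) : 0 <= En t.+1 w s' + eta - En t (child w s' q') (s' / B).
    by rewrite subr_ge0; exact: st.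
  have h2 : En t.+1 w s' <= avg (fun q' : {ffun 'I_N -> 'I_b.+1} =>
      En t (child w s' q') (s' / B)) by exact: energy_le_avg.
  have hm : Num.min (c0 / 4) (kappa * tau ^+ 2) <= c0 / 4 by rewrite ge_min lexx.
  have := @term_le_avg R N b _ q eta dev.
  rewrite avgB avg_cst -/n neta => h.
  have {}low : En t (child w s' q) (s' / B) <= c0 / 2 := low.
  have {}e' : c0 <= En t.+1 w s' := e'.
  have : En t.+1 w s' + eta - En t (child w s' q) (s' / B) <= c0 / 4.
    by apply: le_trans hm; apply: h; lra.
  lra.
have dev : avg (fun q' : {ffun 'I_N -> 'I_b.+1} => (slope b (G i) j t (child w s' q') (s' / B)
    - slope b (G i) j t.+1 w s') ^+ 2) <= eta / kappa.
  rewrite ler_pdivlMr // mulrC.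
  have st' : avg (fun q : {ffun 'I_N -> 'I_b.+1} => En t (child w s' q) (s' / B))
      <= En t.+1 w s' + eta.
    by rewrite -(avg_cst N b (En t.+1 w s' + eta)); apply: avg_le => q'; exact: st.
  have := @energy_avg R N b Z I G kappa t w s' s'pos; rewrite -/En -/B => eq1.
  have : kappa * \sum_ij avg (fun q : {ffun 'I_N -> 'I_b.+1} =>
      (slopes b G ij t (child w s' q) (s' / B) - slopes b G ij t.+1 w s') ^+ 2) <= eta.
    by rewrite -eq1; lra.
  apply: le_trans; rewrite ler_wpM2l ?(ltW kappa0) // (bigD1 (i, j)) //= lerDl.
  apply: sumr_ge0 => ij _; rewrite -(avg_cst N b (0 : R)).
  by apply: avg_le => q'; exact: sqr_ge0.
have := @term_le_avg R N b _ q _ (fun q => sqr_ge0 _) dev.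
rewrite -/n mulrA neta => h.
rewrite -(@ler_pXn2r _ 2) ?nnegrE // ?(ltW tau0) // real_normK ?num_real //.
apply: le_trans h _; rewrite ler_pdivrMr // (mulrC (tau ^+ 2)).
by rewrite ge_min lexx orbT.
Qed.
(** * Second-order expansion at contact points *)

Section CubeAffine.
Variables (R : realType) (N b : nat) (G : 'rV[R]_N -> R) (L : R).
Local Notation V := 'rV[R]_N.
Local Notation cells := {ffun 'I_N -> 'I_b.+1}.
Local Notation B := (b.+1%:R : R).
Hypothesis L0 : 0 <= L.
Hypothesis lipG : forall x y, `|G x - G y| <= L * `|x - y|.

Lemma norm_sub_cell (o : V) (s : R) (q : cells) x y : 0 < s ->
  incube (child o s q) (s / B) x -> incube (child o s q) (s / B) y -> `|x - y| <= s / B.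
Proof.
move=> s0 hx hy; apply: norm_le => [|i]; first by rewrite divr_ge0 // ltW.
rewrite [(x - y) _ _]mxE [(- y) _ _]mxE ler_norml; move: (hx i) (hy i).
move: (s / B) (child o s q ord0 i) (x ord0 i) (y ord0 i) => h o' x' y'.
by move=> /andP[? ?] /andP[? ?]; apply/andP; split; lra.
Qed.

(** The node is reached from [o] by changing one coordinate at a time, each change being a row
    increment; hence the factor [N]. *)
Lemma node_affine (o : V) s t (a : V) tau (q : cells) : 0 < s -> 0 <= tau ->
  (forall j (q : cells), `|slope b G j t (child o s q) (s / B) - a ord0 j| <= tau) ->
  `|G (child o s q) - G o - dot a (child o s q - o)| <= N%:R * (s * tau + 2 * L * (s / B)).
Proof.
move=> s0 tau0 sl; set h := s / B.
have h0 : 0 < h by rewrite divr_gt0 // B_gt0.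
have sE : s = B * h by rewrite mulrC divfK ?B_neq0.
pose trunc l : 'I_N -> nat := fun i => if (i < l)%N then coords q i else 0%N.
have truncle l i : (trunc l i < b.+1)%N by rewrite /trunc; case: ifP => // _; exact: ltn_ord.
pose E k := G (o + h *: vecn R k) - G o - h * dot a (vecn R k).
set e := s * tau + 2 * L * h.
suff main l : (l <= N)%N -> `|E (trunc l)| <= l%:R * e.
  have := main N (leqnn N); rewrite (_ : trunc N = coords q).
    by rewrite /E /child -/h (addrC o) addrK dotZr.
  by apply/funext => i; rewrite /trunc ltn_ord.
elim: l => [_|l IH lN].
  rewrite /E (_ : vecn R _ = 0) ?scaler0 ?addr0 ?dot0r ?mulr0 ?subrr ?subr0 ?subrr ?normr0 ?mul0r //.
  by apply/rowP => i; rewrite !mxE.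
have {}IH := IH (ltnW lN); pose j := Ordinal lN.
have t0 : trunc l = upd (trunc l) j 0.
  apply/funext => i; rewrite /upd; case: eqP => // ->; by rewrite /trunc ltnn.
have t1 : trunc l.+1 = upd (trunc l) j (coords q j).
  apply/funext => i; rewrite /upd /trunc; case: eqP => [->|/eqP ij]; first by rewrite ltnS leqnn.
  rewrite ltnS leq_eqVlt; case: eqP => //= il.
  by case/negP: ij; apply/eqP/val_inj.
have step : `|E (trunc l.+1) - E (trunc l)| <= e.
  have := @row_increment R N b G L lipG L0 j t (trunc l) o h (coords q j) (a ord0 j) tau h0 tau0.
  rewrite -t1 -t0 => /(_ _) hh.
  have -> : E (trunc l.+1) - E (trunc l) =
      G (o + h *: vecn R (trunc l.+1)) - G (o + h *: vecn R (trunc l)) - (coords q j)%:R * h * a ord0 j.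
    rewrite /E; have -> : vecn R (trunc l.+1) = vecn R (trunc l) + (coords q j)%:R *: evec R j.
      by rewrite t1 -[coords q j]add0n vecn_upd -t0.
    by rewrite dotDr dotZr /evec dot_delta; ring.
  apply: le_trans (hh _) _ => [r rq|].
    have rb : (r < b.+1)%N by apply: ltn_trans rq _; exact: ltn_ord.
    pose q' : cells := [ffun i => inord (upd (trunc l) j r i)].
    have -> : upd (trunc l) j r = coords q'.
      apply/funext => i; rewrite /coords ffunE inordK // /upd; case: eqP => // _.
    exact: sl.
  rewrite lerD2r ler_wpM2r // sE ler_wpM2r ?(ltW h0) // ler_nat ltnW //; exact: ltn_ord.
rewrite -natr1 mulrDl mul1r.
rewrite -[E (trunc l.+1)](subrK (E (trunc l))) addrC; apply: le_trans (ler_normD _ _) _.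
exact: lerD.
Qed.

Lemma cube_affine (o : V) s t (a : V) tau x : 0 < s -> 0 <= tau ->
  (forall j, `|a ord0 j| <= L) ->
  (forall j (q : cells), `|slope b G j t (child o s q) (s / B) - a ord0 j| <= tau) ->
  incube o s x ->
  `|G x - G o - dot a (x - o)| <= s * (N%:R * tau + (3 * N%:R + 1) * L / B).
Proof.
move=> s0 tau0 aL sl ox; have [q xq] := incube_split b s0 ox.
have hs : 0 < s / B by rewrite divr_gt0 // B_gt0.
have qq : incube (child o s q) (s / B) (child o s q).
  by move=> i; rewrite lexx ltrDl.
have d1 := norm_sub_cell s0 xq qq.
have h1 := node_affine q s0 tau0 sl.
have h2 : `|G x - G (child o s q)| <= L * (s / B).
  by apply: le_trans (lipG _ _) _; rewrite ler_wpM2l.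
have h3 : `|dot a (x - child o s q)| <= N%:R * (L * (s / B)).
  apply: le_trans (dot_le _ _) _; rewrite ler_wpM2l // ler_pM //.
  exact: norm_le.
have -> : dot a (x - o) = dot a (x - child o s q) + dot a (child o s q - o).
  by rewrite -dotDr addrA subrK.
have -> : s * (N%:R * tau + (3 * N%:R + 1) * L / B) =
   N%:R * (s * tau + 2 * L * (s / B)) + L * (s / B) + N%:R * (L * (s / B)) by ring.
move: h1 h2 h3; rewrite !ler_norml; move: (s / B) => h.
by move=> /andP[? ?] /andP[? ?] /andP[? ?]; apply/andP; split; lra.
Qed.

End CubeAffine.

(** * Gradients of semiconvex functions at contact points *)

Section TwoSided.
Variables (R : realType) (N : nat).
Local Notation V := 'rV[R]_N.

(** Semiconvexity; [Gf] is a selection of generalized subgradients, not a derivative. *)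
Definition lower_support (lam : R) (f : V -> R) (Gf : V -> V) :=
  forall x y, f x + dot (Gf x) (y - x) - lam * dot (y - x) (y - x) <= f y.

Definition two_sided (lam : R) (f : V -> R) (Gf : V -> V) z :=
  forall y, `|f y - f z - dot (Gf z) (y - z)| <= lam * dot (y - z) (y - z).

(** The affine bound on [f + g] minus the lower support of one function bounds the other from above,
    with the same constant. *)
Lemma contact_two_sided lam f g Gf Gg p z : 0 <= lam ->
  lower_support lam f Gf -> lower_support lam g Gg ->
  (forall y, f y + g y <= f z + g z + dot p (y - z)) ->
  [/\ Gf z + Gg z = p, two_sided lam f Gf z & two_sided lam g Gg z].
Proof.
move=> lam0 sf sg ct.
have pE : Gf z + Gg z = p.
  apply/eqP; rewrite eq_sym -subr_eq0; apply/eqP.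
  apply: (@dot_eq0_of_quadratic_bound _ _ _ (2 * lam)); first by rewrite mulr_ge0.
  move=> d; have := ct (z + d); have := sf z (z + d); have := sg z (z + d).
  rewrite (addrC z) addrK !dotE; lra.
split=> // y; rewrite ler_norml; have := ct y; have := sf z y; have := sg z y;
  by rewrite -pE dotDl => *; apply/andP; split; lra.
Qed.

(** Expanding [f] at [y + w] from [x] and from [y] bounds the gradient difference along [w]; taking
    [w] to be plus or minus [|x - y|] times a coordinate vector balances the quadratic errors. *)
Lemma two_sided_lip lam f Gf x y i : 0 <= lam ->
  two_sided lam f Gf x -> two_sided lam f Gf y ->
  `|Gf x ord0 i - Gf y ord0 i| <= 3 * lam * (N%:R + 1) * `|x - y|.
Proof.
move=> lam0 tx ty; have [->|xy] := eqVneq x y; first by rewrite !subrr !normr0 mulr0.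
have t0 : 0 < `|x - y| by rewrite normr_gt0 subr_eq0.
have main w : dot (Gf x - Gf y) w <= 3 * lam * (dot w w + dot (y - x) (y - x)).
  have := tx (y + w); have := ty (y + w); have := tx y.
  have -> : y + w - y = w by rewrite addrC addKr.
  have -> : y + w - x = w + (y - x) by rewrite addrAC addrC.
  rewrite !ler_norml => /andP[_ h1] /andP[_ h2] /andP[h3 _].
  have h4 := dotxx_ge0 (w - (y - x)).
  move: h1 h2 h3 h4; move: (y - x) => D; rewrite !(dotDl, dotDr, dotNl, dotNr) (dotC D w).
  move: (f _) (f _) (f _) (dot w w) (dot D D) (dot w D).
  move: (dot (Gf x) w) (dot (Gf y) w) (dot (Gf x) D) => *; nra.
have sgn (e : R) : e ^+ 2 = 1 ->
    e * (Gf x ord0 i - Gf y ord0 i) <= 3 * lam * (N%:R + 1) * `|x - y|.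
  move=> e1; have := main ((e * `|x - y|) *: delta_mx ord0 i).
  rewrite !dotZr !dotZl !dot_delta !mxE !eqxx /=.
  have hd := dotxx_le (y - x); rewrite -(distrC x y) in hd.
  have -> : e * `|x - y| * (e * `|x - y| * 1) = e ^+ 2 * `|x - y| ^+ 2 by ring.
  rewrite e1 mul1r => h.
  rewrite -(ler_pM2r t0); apply: le_trans (_ : _ <= 3 * lam * (`|x - y| ^+ 2 + dot (y - x) (y - x))) _.
    by apply: le_trans h; rewrite mulrAC.
  rewrite -!mulrA -expr2; rewrite (_ : (N%:R + 1) * _ = `|x - y| ^+ 2 + N%:R * `|x - y| ^+ 2); last by ring.
  by rewrite !ler_wpM2l // lerD2l.
rewrite ler_norml; apply/andP; split.
  by have := sgn (-1); rewrite sqrrN expr1n mulN1r => /(_ erefl); lra.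
by have := sgn 1; rewrite expr1n mul1r; apply.
Qed.

(** The gradients are controlled only on the contact set, whereas the grid argument evaluates at all
    corners. The infimum of the cones with vertices over [Z] is the extension. *)
Lemma mcshane (Z : set V) (g : V -> R) L : 0 <= L ->
  (forall x y, Z x -> Z y -> g x - g y <= L * `|x - y|) ->
  exists G, (forall x y, `|G x - G y| <= L * `|x - y|) /\ forall z, Z z -> G z = g z.
Proof.
move=> L0 lg; have [[z0 Zz0]|Z0] := pselect (Z !=set0); last first.
  exists (fun=> 0); split=> [x y|z Zz]; first by rewrite subrr normr0 mulr_ge0.
  by case: Z0; exists z.
pose S x := [set g z + L * `|x - z| | z in Z].
have S0 x : S x !=set0 by exists (g z0 + L * `|x - z0|), z0.
have Slb x : has_lbound (S x).
  exists (g z0 - L * `|x - z0|) => _ [z Zz <-].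
  have := lg z0 z Zz0 Zz; have := ler_distD x z0 z; rewrite (distrC z0 x) => tri.
  have := ler_wpM2l L0 tri; rewrite mulrDr; lra.
pose G x := inf (S x).
have half x y : G x - G y <= L * `|x - y|.
  rewrite lerBlDr -lerBlDl; apply: lb_le_inf => // _ [z Zz <-].
  rewrite lerBlDl; apply: (@le_trans _ _ (g z + L * `|x - z|)).
    by apply: ge_inf => //; exists z.
  have := ler_wpM2l L0 (ler_distD y x z); rewrite mulrDr; lra.
exists G; split=> [x y|z Zz].
  rewrite ler_norml; apply/andP; split; last exact: half.
  by have := half y x; rewrite (distrC y x); lra.
apply/eqP; rewrite eq_le; apply/andP; split.
  by apply: ge_inf => //; exists z => //; rewrite subrr normr0 mulr0 addr0.
apply: lb_le_inf => // _ [w Zw <-]; have := lg z w Zz Zw; lra.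
Qed.

End TwoSided.

(** * Quadratic expansion along rays *)

Section RayQuadratic.
Variables (R : realType) (N b : nat).
Local Notation V := 'rV[R]_N.
Local Notation cells := {ffun 'I_N -> 'I_b.+1}.
Local Notation B := (b.+1%:R : R).
Variables (lam : R) (f : V -> R) (Gf : V -> V) (Z : set V) (Gt : 'I_N -> V -> R).
Variables (o : V) (s : R) (M : 'M[R]_N) (L E : R).
Hypothesis s0 : 0 < s.
Hypothesis lam0 : 0 <= lam.
Hypothesis L0 : 0 <= L.
Hypothesis E0 : 0 <= E.
Hypothesis twoZ : forall z, Z z -> two_sided lam f Gf z.
Hypothesis GtE : forall z i, Z z -> Gt i z = Gf z ord0 i.
Hypothesis denseZ : forall q : cells, exists2 z, Z z & incube (child o s q) (s / B) z.
Hypothesis affG : forall i x, incube o s x ->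
  `|Gt i x - Gt i o - ((x - o) *m M) ord0 i| <= s * E.
Hypothesis ML : forall i j, `|M i j| <= L.

(** The cell of [c + r *: d] contains a contact point [z]. The expansion at [z] gives the increment
    of [f] as [Gf z] times the step, and near affinity of the gradient replaces [Gf z] by
    [Gf c + r *: (d *m M)]. *)
Lemma ray_step (c d : V) (r : R) : Z c -> `|d| <= s -> incube o s c ->
  incube o s (c + r *: d) ->
  `|f (c + (r + B^-1) *: d) - f (c + r *: d) - B^-1 * dot (Gf c) d
     - r * (B^-1 * dot (d *m M) d)| <=
  (s / B) * (N%:R * (2 * (s * E) + N%:R * (L * (s / B))) + 5 * lam * N%:R * (s / B)).
Proof.
move=> Zc ds oc oy; set y := c + r *: d; set h := s / B.
have h0 : 0 <= h by rewrite divr_ge0 // ltW.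
pose del := B^-1 *: d.
have delh : `|del| <= h.
  by rewrite normrZ ger0_norm ?invr_ge0 // /h mulrC ler_wpM2r ?invr_ge0.
have -> : c + (r + B^-1) *: d = y + del by rewrite scalerDl addrA.
have [q yq] := incube_split b s0 oy; have [z Zz zq] := denseZ q.
have oz := incube_child s0 zq.
have yz := norm_sub_cell s0 yq zq; rewrite -/h -/y in yz.
have sq (x : V) k : 0 <= k -> `|x| <= k -> lam * dot x x <= lam * N%:R * k ^+ 2.
  move=> k0 xk; rewrite -mulrA ler_wpM2l //; apply: le_trans (dotxx_le x) _.
  by rewrite ler_wpM2l // ler_pXn2r ?nnegrE.
have t1 := twoZ Zz y; have t2 := twoZ Zz (y + del).
have s1 := sq _ _ h0 yz.
have s2 : lam * dot (y + del - z) (y + del - z) <= lam * N%:R * (2 * h) ^+ 2.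
  apply: sq; first by rewrite mulr_ge0.
  by rewrite addrAC mulr_natl mulr2n; apply: le_trans (ler_normD _ _) _; exact: lerD.
pose w := Gf z - Gf c - r *: (d *m M).
have wN : `|w| <= 2 * (s * E) + N%:R * (L * h).
  apply: norm_le => [|i].
    by rewrite addr_ge0 // !mulr_ge0 // ltW.
  have a1 := affG i oz; have a2 := affG i oc; rewrite (GtE i Zz) in a1; rewrite (GtE i Zc) in a2.
  have a3 : `|((z - y) *m M) ord0 i| <= N%:R * (L * h).
    apply: le_trans (coord_le_norm _ _) _; apply: le_trans (norm_mulmx_le _ ML) _.
    by rewrite !ler_wpM2l // distrC.
  have -> : w ord0 i = (Gf z ord0 i - Gt i o - ((z - o) *m M) ord0 i)
      - (Gf c ord0 i - Gt i o - ((c - o) *m M) ord0 i) + ((z - y) *m M) ord0 i.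
    rewrite /w /y !mulmxBl mulmxDl -scalemxAl.
    move: (z *m M) (c *m M) (o *m M) (d *m M) (Gt i o) => z' c' o' d' g.
    by rewrite !mxE; ring.
  move: a1 a2 a3; rewrite !ler_norml => /andP[? ?] /andP[? ?] /andP[? ?].
  by apply/andP; split; lra.
have wd : `|dot w del| <= N%:R * ((2 * (s * E) + N%:R * (L * h)) * h).
  apply: le_trans (dot_le _ _) _; apply: ler_wpM2l => //.
  exact: ler_pM.
have -> : f (y + del) - f y - B^-1 * dot (Gf c) d - r * (B^-1 * dot (d *m M) d)
  = (f (y + del) - f z - dot (Gf z) (y + del - z)) - (f y - f z - dot (Gf z) (y - z))
    + dot w del.
  by rewrite /w /del !dotE; ring.
move: t1 t2 wd s1 s2; rewrite !ler_norml => /andP[? ?] /andP[? ?] /andP[? ?] ? ?.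
by apply/andP; split; lra.
Qed.

(* Along the ray the increments of [f] are read off a contact point in the cell of
   each node; working on rays avoids having to know that [M] is symmetric. *)
Lemma ray_quadratic (c d : V) : Z c -> `|d| <= s ->
  (forall t, 0 <= t <= 1 -> incube o s (c + t *: d)) ->
  `|f (c + d) - f c - dot (Gf c) d - 2^-1 * dot (d *m M) d| <=
  s ^+ 2 * (2 * N%:R * E + (2 * N%:R ^+ 2 * L + 5 * N%:R * lam) / B).
Proof.
move=> Zc ds seg; pose be := B^-1; set h := s / B.
have beB : B * be = 1 by rewrite divff ?B_neq0.
have be0 : 0 <= be by rewrite invr_ge0.
have oc : incube o s c by rewrite -[c]addr0 -(scale0r d); apply: seg; rewrite lexx ler01.
set e := (s / B) * (N%:R * (2 * (s * E) + N%:R * (L * (s / B))) + 5 * lam * N%:R * (s / B)).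
pose q := dot (d *m M) d; pose g := dot (Gf c) d.
(* Sum of the first [r] steps: [r * (r - 1) / 2] is the sum of the node indices, and its deficit
   from [r ^+ 2 / 2] at the last node is an error of order [1 / B]. *)
have main r : (r <= b.+1)%N ->
    `|f (c + (r%:R * be) *: d) - f c - r%:R * be * g
      - r%:R * (r%:R - 1) * be ^+ 2 * 2^-1 * q| <= r%:R * e.
  elim: r => [_|r IH rb].
    by rewrite !mul0r scale0r addr0 !subrr !normr0.
  have {}IH := IH (ltnW rb).
  have := @ray_step c d (r%:R * be) Zc ds oc; rewrite -/be -/g -/q -/e.
  have -> : r%:R * be + be = r.+1%:R * be by rewrite -natr1 mulrDl mul1r.
  move=> /(_ _) st.
  have {st} : `|f (c + (r.+1%:R * be) *: d) - f (c + (r%:R * be) *: d) - be * g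
     - r%:R * be * (be * q)| <= e.
    by apply: st; apply: seg; rewrite mulr_ge0 //= -[leRHS]beB ler_wpM2r // ler_nat ltnW.
  move: IH; rewrite -(natr1 r) !ler_norml.
  have -> : (r%:R + 1) * (r%:R + 1 - 1) * be ^+ 2 * 2^-1 * q =
    r%:R * (r%:R - 1) * be ^+ 2 * 2^-1 * q + r%:R * be * (be * q).
    by field.
  by move=> /andP[? ?] /andP[? ?]; apply/andP; split; lra.
have := main _ (leqnn b.+1); rewrite beB !mul1r scale1r.
have qb : `|q| <= N%:R * (N%:R * (L * s) * s).
  apply: le_trans (dot_le _ _) _; rewrite ler_wpM2l // ler_pM //.
  by apply: le_trans (norm_mulmx_le _ ML) _; rewrite !ler_wpM2l.
have -> : B * (B - 1) * be ^+ 2 * 2^-1 * q = 2^-1 * q - 2^-1 * be * q.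
  have -> : B * (B - 1) * be ^+ 2 * 2^-1 * q = (B * be) * (B * be - be) * 2^-1 * q by ring.
  by rewrite beB; ring.
have -> : B * e = s ^+ 2 * (2 * N%:R * E + (N%:R ^+ 2 * L + 5 * N%:R * lam) * be).
  rewrite /e -/be.
  have -> : B * (s * be * (N%:R * (2 * (s * E) + N%:R * (L * (s * be))) + 5 * lam * N%:R * (s * be))) =
    (B * be) * (s * (N%:R * (2 * (s * E) + N%:R * (L * (s * be))) + 5 * lam * N%:R * (s * be))) by ring.
  by rewrite beB; ring.
have q2 : `|2^-1 * be * q| <= s ^+ 2 * (N%:R ^+ 2 * L * be).
  rewrite !normrM (ger0_norm be0) ger0_norm ?invr_ge0 // -mulrA.
  apply: (@le_trans _ _ (be * `|q|)).
    by rewrite ler_piMl ?mulr_ge0 // invf_le1 ?ler1n.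
  apply: le_trans (ler_wpM2l be0 qb) _; rewrite le_eqVlt; apply/orP; left; apply/eqP; ring.
have -> : s ^+ 2 * (2 * N%:R * E + (2 * N%:R ^+ 2 * L + 5 * N%:R * lam) / B) =
  s ^+ 2 * (2 * N%:R * E + (N%:R ^+ 2 * L + 5 * N%:R * lam) * be) + s ^+ 2 * (N%:R ^+ 2 * L * be).
  by rewrite -/be; ring.
move: q2; rewrite -/g -/q !ler_norml => /andP[? ?] /andP[? ?].
by apply/andP; split; lra.
Qed.

End RayQuadratic.
(** A grid of [m ^ N] slopes in the ball of radius [rho] is realised at contact points, and the
    Lipschitz bound keeps these points apart at the scale of the subcubes. The resulting density is
    independent of [T], as [good_cube] demands. *)
Lemma contact_density (R : realType) (N b kap K : nat) (Z : set 'rV[R]_N)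
    (Gp : 'rV[R]_N -> 'rV[R]_N) (L rho R1 : R) T :
  0 < L -> 0 < rho -> 0 <= R1 -> (0 < kap)%N -> (0 < K)%N -> b.+1 = (kap * K)%N ->
  L * (2 * R1 + 1) <= 2 * rho * kap%:R ->
  (forall x y i, Z x -> Z y -> `|Gp x ord0 i - Gp y ord0 i| <= L * `|x - y|) ->
  (forall p, `|p| <= rho -> exists2 z, Z z & `|z| <= R1 /\ Gp z = p) ->
  kap%:R^-1 ^+ N <= cdens b Z T.+1 (const_mx (- R1)) (2 * R1 + 1).
Proof.
move=> L0 rho0 R10 kap0 K0 bE Lk lipG surj; set s0 := 2 * R1 + 1.
have s00 : 0 < s0 by rewrite /s0; lra.
have /choice[xp hxp] : forall p, exists z,
    `|p| <= rho -> [/\ Z z, `|z| <= R1 & Gp z = p].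
  move=> p; have [pr|pr] := pselect (`|p| <= rho); last by exists 0.
  by have [z Zz [z1 z2]] := surj p pr; exists z.
(* Number of slopes per axis; [kap * m] is the number of subcubes per axis at depth [T.+1], so the
   slope grid is coarser by the factor [kap]. *)
pose m := (K * b.+1 ^ T)%N.
have m0 : (0 < m)%N by rewrite muln_gt0 K0 expn_gt0.
have mE : (kap * m)%N = (b.+1 ^ T.+1)%N by rewrite mulnA -bE expnS.
have mR0 : 0 < m%:R :> R by rewrite ltr0n.
have kR0 : 0 < kap%:R :> R by rewrite ltr0n.
pose p (k : {ffun 'I_N -> 'I_m}) : 'rV[R]_N := \row_i (- rho + 2 * rho * (k i)%:R / m%:R).
have prho k : `|p k| <= rho.
  apply: norm_le => [|i]; first exact: ltW.
  have h1 : 0 <= (k i)%:R / m%:R :> R by rewrite divr_ge0.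
  have h2 : (k i)%:R / m%:R <= 1 :> R by rewrite ler_pdivrMr // mul1r ler_nat ltnW.
  rewrite mxE ler_norml -mulrA; move: h1 h2; move: (_ / _) => q *.
  by apply/andP; split; nra.
have sep k k' : (forall i, `|xp (p k) ord0 i - xp (p k') ord0 i| < s0 / b.+1%:R ^+ T.+1) -> k = k'.
  move=> close; apply/ffunP => i; apply/val_inj => /=.
  have [Zx _ Gx] := hxp _ (prho k); have [Zy _ Gy] := hxp _ (prho k').
  have B0 : 0 < b.+1%:R ^+ T.+1 :> R by rewrite exprn_gt0 // ltr0n.
  have lt1 : `|xp (p k) - xp (p k')| < s0 / b.+1%:R ^+ T.+1.
    by apply: norm_lt => [|i']; rewrite ?divr_gt0 //; have := close i'; rewrite !mxE.
  have := lipG _ _ i Zx Zy; rewrite Gx Gy !mxE => lip.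
  have {lip} : `|(k i)%:R - (k' i)%:R| * (2 * rho / m%:R) < L * (s0 / b.+1%:R ^+ T.+1) :> R.
    apply: (@le_lt_trans _ _ (L * `|xp (p k) - xp (p k')|)); last by rewrite ltr_pM2l.
    apply: le_trans lip.
    rewrite -[X in _ * X]ger0_norm ?divr_ge0 ?mulr_ge0 ?(ltW rho0) // -normrM.
    by rewrite le_eqVlt; apply/orP; left; apply/eqP; congr `|_|; ring.
  rewrite -natrX -mE natrM => h.
  have : `|(k i)%:R - (k' i)%:R| < 1 :> R.
    have rm : 0 < 2 * rho / m%:R by rewrite divr_gt0 // mulr_gt0.
    rewrite -(ltr_pM2r rm) mul1r; apply: lt_le_trans h _.
    by rewrite mulrA invfM mulrA ler_pM2r ?invr_gt0 // ler_pdivrMr.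
  rewrite ltr_norml => /andP[h1 h2].
  have : ((k i)%:R < ((k' i).+1)%:R :> R) by rewrite -natr1; lra.
  have : ((k' i)%:R < ((k i).+1)%:R :> R) by rewrite -natr1; lra.
  rewrite !ltr_nat !ltnS => h3 h4; apply/eqP; by rewrite eqn_leq h3 h4.
pose P := [seq xp (p k) | k <- enum {: {ffun 'I_N -> 'I_m}}].
have uP : uniq P.
  rewrite map_inj_uniq ?enum_uniq // => k k' e; apply: sep => i.
  by rewrite e subrr normr0 divr_gt0 // exprn_gt0 // ltr0n.
have := @size_le_cdens R N b Z T.+1 (const_mx (- R1)) s0 P s00 uP.
rewrite size_map -cardE card_ffun !card_ord => h.
have {h} : (m ^ N)%:R <= cdens b Z T.+1 (const_mx (- R1)) s0 * (b.+1 ^ N)%:R ^+ T.+1.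
  apply: h => [z /mapP[k _ ->]|z z' /mapP[k _ ->] /mapP[k' _ ->] close]; last by rewrite (sep _ _ close).
  have [Zx xR _] := hxp _ (prho k); split=> // i; rewrite mxE.
  have := coord_le_norm (xp (p k)) i; rewrite ler_norml => /andP[h1 h2].
  by apply/andP; split; rewrite /s0; lra.
rewrite -natrX -expnM mulnC expnM -mE expnMn natrM mulrC.
set C := cdens _ _ _ _ _; rewrite mulrAC => h.
have mN0 : 0 < (m ^ N)%:R :> R by rewrite ltr0n expn_gt0 m0.
have kN0 : 0 < (kap ^ N)%:R :> R by rewrite ltr0n expn_gt0 kap0.
have {}h : 1 <= (kap ^ N)%:R * C by rewrite -(ler_pM2r mN0) mul1r.
by rewrite exprVn -natrX -[_^-1]mulr1 mulrC ler_pdivrMr // mulrC.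
Qed.
(** With at least four cells per side, the central cell stays a quarter of the side away from the
    faces. *)
Lemma center_segment (R : realType) (N b : nat) (o : 'rV[R]_N) s
    (q : {ffun 'I_N -> 'I_b.+1}) c d t :
  0 < s -> (3 <= b)%N -> (forall i, coords q i = b.+1./2) ->
  incube (child o s q) (s / b.+1%:R) c -> `|d| <= s / 4 -> 0 <= t <= 1 ->
  incube o s (c + t *: d).
Proof.
move=> s0 b3 qE hc ds /andP[t0 t1] i; have := hc i; rewrite !mxE qE.
have := coord_le_norm d i; set h := s / _.
have h0 : 0 < h by rewrite divr_gt0 // ltr0n.
have sE : s = b.+1%:R * h by rewrite mulrC divfK // pnatr_eq0.
have e1 : b.+1%:R <= 2 * (b.+1./2)%:R + 1 :> R.
  rewrite -natrM natr1 ler_nat mul2n -(add1n (b.+1./2).*2).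
  by rewrite -[X in (X <= _)%N]odd_double_half leq_add2r leq_b1.
have e2 : 2 * (b.+1./2)%:R <= b.+1%:R :> R.
  by rewrite -natrM ler_nat mul2n -[X in (_ <= X)%N]odd_double_half leq_addl.
have e3 : 4 <= b.+1%:R :> R by rewrite ler_nat.
move=> di /andP[c1 c2].
have : `|t * d ord0 i| <= s / 4.
  rewrite normrM ger0_norm //; apply: le_trans ds; apply: le_trans di.
  by rewrite ler_piMl.
rewrite ler_norml => /andP[k1 k2].
move: e1 e2 e3 sE c1 c2 k1 k2; set k := (b.+1./2)%:R; set Bb := b.+1%:R.
move=> e1 e2 e3 sE c1 c2 k1 k2.
by apply/andP; split; nra.
Qed.

(** Finitary substitute for Alexandrov's theorem and Jensen's lemma: the expansion holds only up to
    [theta], at a single scale [H] and around one contact point, but for [f] and [g]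
    simultaneously. *)
Lemma approx_second_order (R : realType) (N : nat) (f g : 'rV[R]_N -> R)
    (Gf Gg : 'rV[R]_N -> 'rV[R]_N) (lam rho R1 : R) :
  0 < lam -> 0 < rho -> lower_support lam f Gf -> lower_support lam g Gg ->
  (forall p, `|p| <= rho -> exists2 x, `|x| <= R1 &
     forall y, f y + g y <= f x + g x + dot p (y - x)) ->
  forall theta s1, 0 < theta -> 0 < s1 ->
  exists c p H (A1 A2 : 'M[R]_N), [/\ `|c| <= R1, `|p| <= rho, 0 < H <= s1,
    forall y, f y + g y <= f c + g c + dot p (y - c) &
    forall d, `|d| <= H ->
      `|f (c + d) - f c - dot (Gf c) d - 2^-1 * dot (d *m A1) d| <= theta * H ^+ 2 /\
      `|g (c + d) - g c - dot (Gg c) d - 2^-1 * dot (d *m A2) d| <= theta * H ^+ 2].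
Proof.
move=> lam0 rho0 sf sg cont theta s1 theta0 s10.
pose Z := [set z | `|z| <= R1 /\ exists2 p, `|p| <= rho &
  forall y, f y + g y <= f z + g z + dot p (y - z)].
have R10 : 0 <= R1.
  by have [|x xR _] := cont 0; rewrite ?normr0 ?(ltW rho0) //; exact: le_trans xR.
pose L : R := 3 * lam * (N%:R + 1).
have L0 : 0 < L by rewrite !mulr_gt0 // ltr_wpDl.
have twoZ z : Z z -> two_sided lam f Gf z /\ two_sided lam g Gg z.
  by move=> [_ [p _ h]]; have [_ ? ?] := contact_two_sided (ltW lam0) sf sg h.
pose s0 := 2 * R1 + 1.
(* Meets the requirement of [contact_density], [2 * L] being a Lipschitz constant of [Gf + Gg] on
   [Z]. *)
pose kap := (Num.truncn (L * s0 / rho)).+1.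
have kapP : 2 * L * s0 <= 2 * rho * kap%:R.
  rewrite -(mulrA 2 L) -(mulrA 2 rho) ler_pM2l // (mulrC rho) -ler_pdivrMr // /kap.
  exact: ltW (truncnS_gt _).
(* [C / b.+1%:R] gathers the errors of order [1 / b.+1] in [ray_quadratic]. The choice of [K] makes
   it at most [theta / 32], and [tau] does the same for the remaining error; the sum [theta / 16]
   matches [H = s / 4]. *)
pose C := 2 * N%:R * ((3 * N%:R + 1) * L) + (2 * N%:R ^+ 2 * L + 5 * N%:R * lam).
have [K [K4 hK]] : exists K, (4 <= K)%N /\ C * 32 / theta <= K%:R.
  exists (Num.truncn (C * 32 / theta)).+4; split => //.
  have h := truncnS_gt (C * 32 / theta); apply: le_trans (ltW h) _.
  by rewrite ler_nat ltnS leqW // leqW.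
have K0 : (0 < K)%N by exact: leq_trans K4.
have [b bE] : exists b, b.+1 = (kap * K)%N.
  by exists (kap * K).-1; rewrite prednK // muln_gt0 K0.
have b3 : (3 <= b)%N.
  by rewrite -ltnS bE; apply: leq_trans K4 (leq_pmull _ _).
pose tau := theta / (64 * (N%:R ^+ 2 + 1)).
have tau0 : 0 < tau by rewrite divr_gt0 // mulr_gt0 // ltr_wpDl // exprn_ge0.
have C0 : 0 <= C by rewrite /C !(addr_ge0, mulr_ge0, exprn_ge0) // ltW.
have CB : C / b.+1%:R <= theta / 32.
  have h : C * 32 / theta <= b.+1%:R by apply: le_trans hK _; rewrite ler_nat bE leq_pmull.
  by rewrite ler_pdivrMr ?ltr0n //; rewrite ler_pdivrMr // in h; lra.
have ext (G : 'rV[R]_N -> 'rV[R]_N) (F : 'rV[R]_N -> R) :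
    (forall z, Z z -> two_sided lam F G z) ->
    exists Gt : 'I_N -> 'rV[R]_N -> R, (forall i x y, `|Gt i x - Gt i y| <= L * `|x - y|)
      /\ forall z i, Z z -> Gt i z = G z ord0 i.
  move=> tw; have /choice[Gt hGt] : forall i, exists g,
      (forall x y, `|g x - g y| <= L * `|x - y|) /\ forall z, Z z -> g z = G z ord0 i.
    move=> i; apply: mcshane => [|x y Zx Zy]; first exact: ltW.
    apply: le_trans (ler_norm _) _; apply: two_sided_lip (ltW lam0) _ _; exact: tw.
  by exists Gt; split=> [i|z i]; [exact: (hGt i).1 | exact: (hGt i).2].
have [Ft [lipF FtE]] := ext Gf f (fun z Zz => (twoZ z Zz).1).
have [Gt [lipG GtE]] := ext Gg g (fun z Zz => (twoZ z Zz).2).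
(* One family for both functions, so that a single cube serves both gradients. *)
pose GG (i : bool * 'I_N) := if i.1 then Ft i.2 else Gt i.2.
have lipGG i x y : `|GG i x - GG i y| <= L * `|x - y|.
  by case: i => -[] i; [exact: lipF | exact: lipG].
have kap0 : 0 < kap%:R^-1 ^+ N :> R by rewrite exprn_gt0 // invr_gt0 ltr0n.
have s00 : 0 < s0 by rewrite /s0; lra.
have b0 : (0 < b)%N by exact: leq_trans b3.
have [T hT] := good_cube Z b0 (ltW L0) lipGG tau0 kap0 s00 s10.
have [|t [w [s [sp ss1 dens sl]]]] := hT (const_mx (- R1)).
  apply: (@contact_density R N b kap K Z (fun z => Gf z + Gg z) (2 * L) rho) => //.
  - by rewrite mulr_gt0.
  - move=> x y i Zx Zy; rewrite !mxE.
    have h1 := two_sided_lip i (ltW lam0) (twoZ x Zx).1 (twoZ y Zy).1.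
    have h2 := two_sided_lip i (ltW lam0) (twoZ x Zx).2 (twoZ y Zy).2.
    rewrite opprD addrACA; apply: le_trans (ler_normD _ _) _.
    by apply: le_trans (lerD h1 h2) _; rewrite -/L -mulrA mulr_natl mulr2n.
  - move=> p pr; have [x xR hx] := cont p pr; exists x; first by split=> //; exists p.
    by split=> //; have [] := contact_two_sided (ltW lam0) sf sg hx.
have hb : (b.+1./2 < b.+1)%N by rewrite -divn2 ltn_Pdiv.
(* The central cell, around which rays of length [s / 4] stay in the cube. *)
pose q : {ffun 'I_N -> 'I_b.+1} := [ffun=> Ordinal hb].
have [c Zc cq] := dens q; have [cR [p pr hp]] := Zc.
pose M (i : bool) : 'M[R]_N := \matrix_(j, k) slope b (GG (i, k)) j t.+1 w s.
exists c, p, (s / 4), (M true), (M false); split=> //.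
  by rewrite divr_gt0 //= ler_pdivrMr //; lra.
pose E := N%:R * tau + (3 * N%:R + 1) * L / b.+1%:R.
have E0 : 0 <= E.
  by rewrite /E !(addr_ge0, mulr_ge0, invr_ge0) // ltW.
have ML i j k : `|M i j k| <= L.
  by rewrite mxE; apply: slope_le => //; exact: ltW.
have aff i k x : incube w s x ->
    `|GG (i, k) x - GG (i, k) w - ((x - w) *m M i) ord0 k| <= s * E.
  move=> wx; have := @cube_affine R N b (GG (i, k)) L (ltW L0) (lipGG (i, k)) w s t
    (\row_j M i j k) tau x sp (ltW tau0).
  have -> : dot (\row_j M i j k) (x - w) = ((x - w) *m M i) ord0 k.
    by rewrite mxE dotC; apply: eq_bigr => j _; rewrite [X in _ * X]mxE.
  apply=> // [j|j q']; first by rewrite mxE.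
  by rewrite !mxE; exact: sl.
have fin : s ^+ 2 * (2 * N%:R * E + (2 * N%:R ^+ 2 * L + 5 * N%:R * lam) / b.+1%:R)
    <= theta * (s / 4) ^+ 2.
  have -> : 2 * N%:R * E + (2 * N%:R ^+ 2 * L + 5 * N%:R * lam) / b.+1%:R =
     2 * N%:R ^+ 2 * tau + C / b.+1%:R by rewrite /E /C; ring.
  have h : 2 * N%:R ^+ 2 * tau <= theta / 32.
    rewrite /tau mulrA ler_pdivrMr; last by rewrite mulr_gt0 // ltr_wpDl // exprn_ge0.
    have n0 : 0 <= N%:R ^+ 2 :> R by rewrite exprn_ge0.
    move: (N%:R ^+ 2) n0 => n n0; nra.
  have -> : theta * (s / 4) ^+ 2 = s ^+ 2 * (theta / 32 + theta / 32) by field.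
  by rewrite ler_wpM2l ?sqr_ge0 // lerD.
move=> d dH.
have seg t' : 0 <= t' <= 1 -> incube w s (c + t' *: d).
  move=> ht; apply: (center_segment sp b3 _ cq dH ht) => i.
  by rewrite /coords ffunE.
have ds : `|d| <= s by apply: le_trans dH _; rewrite ler_pdivrMr //; lra.
split; apply: le_trans fin.
- apply: (@ray_quadratic R N b lam f Gf Z Ft w s (M true) L E) => //; try exact: ltW.
  + by move=> z /twoZ[].
  + by move=> i x; exact: (aff true i x).
- apply: (@ray_quadratic R N b lam g Gg Z Gt w s (M false) L E) => //; try exact: ltW.
  + by move=> z /twoZ[].
  + by move=> i x; exact: (aff false i x).
Qed.
(** * Sup-convolution and touching quadratics *)

Section Calm.
Variables (R : realType) (N : nat).
Local Notation V := 'rV[R]_N.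

(** One-sided local Lipschitz bound: stable under sums, satisfied by quadratics, and enough for
    upper semicontinuity. *)
Definition upcalm (h : V -> R) := forall x, exists2 M, 0 <= M &
  forall y, `|y - x| <= 1 -> h y <= h x + M * `|y - x|.

Lemma upcalmD h k : upcalm h -> upcalm k -> upcalm (fun x => h x + k x).
Proof.
move=> hh hk x; have [M M0 hM] := hh x; have [M' M'0 hM'] := hk x.
exists (M + M') => [|y yx]; first exact: addr_ge0.
by have := hM y yx; have := hM' y yx; rewrite mulrDl; lra.
Qed.

Lemma upcalm_shift h (c : V) : upcalm h -> upcalm (fun x => h (c + x)).
Proof.
move=> hh x; have [M M0 hM] := hh (c + x); exists M => // y yx.
by have := hM (c + y); rewrite opprD addrACA subrr add0r; exact.
Qed.

Lemma upcalm_quad c p A : A^T = A -> upcalm (fun x : V => - quad c p A x).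
Proof.
move=> sA x; exists (N%:R * `|p + x *m A| + N%:R * N%:R * `|A| * N%:R) => [|y yx].
  by rewrite addr_ge0 // !mulr_ge0.
have -> : y = x + (y - x) by rewrite addrC subrK.
move: (y - x) yx => d d1; rewrite (addrC x d) addrK addrC quad_shift //.
have h1 := dot_le (p + x *m A) d; have h2 := qform_ge A d.
have h3 : N%:R * N%:R * `|A| * dot d d <= N%:R * N%:R * `|A| * N%:R * `|d|.
  rewrite -[leRHS]mulrA ler_wpM2l ?mulr_ge0 //; apply: le_trans (dotxx_le d) _.
  by rewrite ler_wpM2l // expr2 ler_piMr.
have h4 : 0 <= N%:R * N%:R * `|A| * N%:R * `|d| by rewrite !mulr_ge0.
move: h1; rewrite ler_norml => /andP[h1 _].
by rewrite mulrDl; lra.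
Qed.

Lemma upcalm_usc h : upcalm h -> forall z t, h z < t -> \forall y \near z, h y < t.
Proof.
move=> hh z t zt; have [M M0 hM] := hh z; apply/near_norm.
have M1 : 0 < M + 1 by rewrite ltr_wpDl.
exists (Num.min 1 ((t - h z) / (M + 1))).
  by rewrite lt_min ltr01 divr_gt0 ?subr_gt0.
move=> y; rewrite lt_min (ltr_pdivlMr _ _ M1) => /andP[y1 y2].
have := hM y (ltW y1); have := normr_ge0 (y - z); nra.
Qed.

Definition usc_on (K : set V) (W : V -> R) :=
  forall x, K x -> forall t, W x < t -> \forall y \near x, K y -> W y < t.

Lemma usc_onD (K : set V) W h : usc_on K W -> upcalm h -> usc_on K (fun x : V => W x + h x).
Proof.
move=> uW ch x Kx t xt; pose e := (t - (W x + h x)) / 2.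
have e0 : 0 < e by rewrite divr_gt0 // subr_gt0.
have : W x < W x + e by rewrite ltrDl.
move=> /(uW x Kx); have : h x < h x + e by rewrite ltrDl.
move=> /(upcalm_usc ch); apply: filterS2 => y h1 h2 Ky; have := h2 Ky; rewrite /e in h1 *; lra.
Qed.

Lemma ball_compact (r : R) : compact [set x : V | `|x| <= r].
Proof.
apply: bounded_closed_compact.
  by exists r; split => [|M rM x /= xr]; [exact: num_real | exact: le_trans xr (ltW rM)].
apply: (@closed_comp _ _ (fun x : V => `|x|) [set y | y <= r]); last exact: closed_le.
by move=> x _; exact: norm_continuous.
Qed.

Lemma upcalm_ball_max h (r : R) : 0 <= r -> upcalm h ->
  exists2 x, `|x| <= r & forall y, `|y| <= r -> h y <= h x.
Proof.
move=> r0 hh; have [||x xr mx] := @usc_compact_max _ _ _ _ h (@ball_compact r).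
- by exists 0; rewrite /= normr0.
- move=> z x _ _ zx; have := upcalm_usc hh zx; apply: filterS => y hy _; exact: hy.
- by exists x.
Qed.

(* The term [4 theta] in the Hessian pushes the maximum of the difference off the
   boundary of the ball of radius [H]. *)
Lemma touch_of_approx f (c a : V) (A : 'M[R]_N) (H theta : R) : upcalm f ->
  0 < H -> 0 < theta ->
  (forall d, `|d| <= H -> f (c + d) - f c - dot a d - 2^-1 * dot (d *m A) d <= theta * H ^+ 2) ->
  let X := 2^-1 *: (A + A^T) + (4 * theta)%:M in
  exists x p, `|x - c| < H /\
    \forall y \near x, f y <= f x + dot p (y - x) + 2^-1 * dot ((y - x) *m X) (y - x).
Proof.
move=> cf H0 theta0 fA X.
have sX : X^T = X by rewrite /X linearD linearZ /= linearD /= trmxK tr_scalar_mx (addrC A^T).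
have XE d : dot (d *m X) d = dot (d *m A) d + 4 * theta * dot d d.
  rewrite /X mulmxDr -scalemxAr mulmxDr mul_mx_scalar !dotDl !dotZl dotDl (dot_trmx A^T) trmxK.
  by field.
pose h d := f (c + d) - quad 0 a X d.
have [|d dH maxd] := @upcalm_ball_max h H (ltW H0).
  by apply: upcalmD; [exact: upcalm_shift | exact: upcalm_quad].
have hd0 : h 0 <= h d by apply: maxd; rewrite normr0 ltW.
have dlt : `|d| < H.
  rewrite lt_neqAle dH andbT; apply/eqP => dE.
  have := fA d dH; have := sqr_norm_le_dot d; rewrite dE.
  move: hd0; rewrite /h /quad !dot0r (addr0 c) XE.
  have H2 : 0 < theta * H ^+ 2 by rewrite mulr_gt0 // exprn_gt0.
  move=> h1 h2 h3; nra.
exists (c + d), (a + d *m X); split; first by rewrite (addrC c) addrK.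
apply/near_norm; exists (H - `|d|); first by rewrite subr_gt0.
move=> y; set e := y - (c + d) => he.
have yE : y = c + (d + e) by rewrite addrA /e addrC subrK.
have deH : `|d + e| <= H by apply: le_trans (ler_normD _ _) _; lra.
have := maxd (d + e) deH; rewrite /h quad_shift // -yE; lra.
Qed.

End Calm.

(** * Sup-convolutions *)

Section SupConvolution.
Variables (R : realType) (N : nat).
Local Notation V := 'rV[R]_N.

Definition supconv (a : R) (K : set V) (W f : V -> R) (Y : V -> V) :=
  [/\ forall x, K (Y x), forall x, f x = W (Y x) - a * dot (x - Y x) (x - Y x)
    & forall x y, K y -> W y - a * dot (x - y) (x - y) <= f x].

Lemma supconv_exists a K W : compact K -> K !=set0 -> usc_on K W ->
  exists f Y, supconv a K W f Y.
Proof.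
move=> cK K0 uW.
have /choice[Y hY] : forall x : V, exists y, K y /\
    forall z, K z -> W z - a * dot (x - z) (x - z) <= W y - a * dot (x - y) (x - y).
  move=> x; suff [y Ky my] : exists2 y, K y & forall z, K z ->
    W z - a * dot (x - z) (x - z) <= W y - a * dot (x - y) (x - y) by exists y.
  have sA : ((2 * a)%:M : 'M[R]_N)^T = (2 * a)%:M by rewrite tr_scalar_mx.
  have qE v : quad (a * dot x x) ((- 2 * a) *: x) (2 * a)%:M v = a * dot (x - v) (x - v).
    by rewrite /quad mul_mx_scalar !dotE (dotC v x); field.
  apply: usc_compact_max => // z w Kz Kw zw.
  have := usc_onD uW (upcalm_quad (a * dot x x) ((- 2 * a) *: x) sA) Kz.
  move=> /(_ (W w - a * dot (x - w) (x - w))); rewrite /= qE => /(_ zw).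
  by apply: filterS => v; rewrite qE.
exists (fun x => W (Y x) - a * dot (x - Y x) (x - Y x)), Y.
by split=> [x||x y Ky] //; [exact: (hY x).1 | exact: (hY x).2].
Qed.

Variables (a : R) (K : set V) (W f : V -> R) (Y : V -> V).
Hypothesis a0 : 0 < a.
Hypothesis fW : supconv a K W f Y.

(** Gradient at [x] of the paraboloid with vertex over [Y x] that touches [f] from below at [x]. *)
Definition supconv_grad x := (2 * a) *: (Y x - x).

Lemma supconv_lower_support : lower_support a f supconv_grad.
Proof.
have [KY fE fge] := fW; move=> x y; apply: le_trans (fge y (Y x) (KY x)).
rewrite (fE x) /supconv_grad.
have -> : y - Y x = (y - x) - (Y x - x) by rewrite opprB addrA subrK.
rewrite -(opprB (Y x) x); move: (y - x) (Y x - x) => d e; rewrite !dotE (dotC d e); lra.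
Qed.

Variables (R0 : R).
Hypothesis KR0 : forall y, K y -> `|y| <= R0.

Lemma supconv_grad_le x : `|supconv_grad x| <= 2 * a * (R0 + `|x|).
Proof.
have [KY _ _] := fW; rewrite normrZ ger0_norm ?mulr_ge0 ?(ltW a0) //.
rewrite ler_wpM2l ?mulr_ge0 ?(ltW a0) //; apply: le_trans (ler_normB _ _) _.
by rewrite lerD2r; exact: KR0.
Qed.

Lemma supconv_loss x d r : `|x| <= r -> `|d| <= 1 ->
  f x - N%:R * (2 * a * (R0 + r) + a) * `|d| <= f (x + d).
Proof.
move=> xr d1; apply: le_trans (supconv_lower_support x (x + d)).
rewrite (addrC x d) addrK.
have h1 : `|dot (supconv_grad x) d| <= N%:R * (2 * a * (R0 + r) * `|d|).
  apply: le_trans (dot_le _ _) _; rewrite ler_wpM2l // ler_wpM2r //.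
  by apply: le_trans (supconv_grad_le x) _; rewrite ler_wpM2l ?mulr_ge0 ?(ltW a0) // lerD2l.
have h2 : a * dot d d <= a * (N%:R * `|d|).
  rewrite ler_wpM2l ?(ltW a0) //; apply: le_trans (dotxx_le d) _.
  by rewrite ler_wpM2l // expr2 ler_piMr.
move: h1; rewrite ler_norml => /andP[h1 _].
have -> : N%:R * (2 * a * (R0 + r) + a) * `|d| =
  N%:R * (2 * a * (R0 + r) * `|d|) + a * (N%:R * `|d|) by ring.
lra.
Qed.

Lemma supconv_upcalm : 0 <= R0 -> upcalm f.
Proof.
move=> R00 x; exists (N%:R * (2 * a * (R0 + (`|x| + 1)) + a)).
  by rewrite mulr_ge0 // addr_ge0 ?(ltW a0) // !mulr_ge0 ?(ltW a0) // !addr_ge0.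
move=> y yx; have := @supconv_loss y (x - y) (`|x| + 1).
rewrite (addrC y) subrK (distrC x y) => /(_ _ yx) h.
rewrite -lerBlDr; apply: h.
by rewrite -[y](subrK x) addrC; apply: le_trans (ler_normD _ _) _; rewrite lerD2l.
Qed.

(** Translation by [x - Y x] keeps the penalty term constant, so contact from above passes from [f]
    to [W] with the same quadratic. *)
Lemma supconv_touch x p X :
  (\forall y \near x, f y <= f x + dot p (y - x) + 2^-1 * dot ((y - x) *m X) (y - x)) ->
  \forall y \near Y x, K y ->
    W y <= W (Y x) + dot p (y - Y x) + 2^-1 * dot ((y - Y x) *m X) (y - Y x).
Proof.
have [KY fE fge] := fW; move=> /near_norm[e e0 he]; apply/near_norm; exists e => // y ye Ky.
have := he (y + (x - Y x)); rewrite (_ : y + (x - Y x) - x = y - Y x); last first.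
  by rewrite addrA addrAC -addrA [RHS]addrC addrA addrK addrC.
move=> /(_ ye); have := fge (y + (x - Y x)) y Ky; rewrite (addrC y) addrK (fE x); lra.
Qed.

End SupConvolution.

(** * Contact points of tilted sums of sup-convolutions *)

Section Jets.
Variables (R : realType) (N : nat).
Local Notation V := 'rV[R]_N.
Variables (K : set V) (R0 C : R).
Hypothesis KR0 : forall y, K y -> `|y| <= R0.
Hypothesis R00 : 0 <= R0.
Hypothesis C0 : 0 <= C.

Lemma supconv_le a W f Y x : 0 < a -> supconv a K W f Y ->
  (forall y, K y -> `|W y| <= C) -> R0 <= `|x| -> f x <= C - a * (`|x| - R0) ^+ 2.
Proof.
move=> a0 [KY fE _] WC xR; rewrite fE lerB //.
  by apply: le_trans (ler_norm _) _; exact: WC.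
rewrite ler_wpM2l ?(ltW a0) //; apply: le_trans (sqr_norm_le_dot _).
rewrite ler_pXn2r ?nnegrE ?subr_ge0 //.
apply: le_trans (lerB_dist _ _); rewrite lerB //; exact: KR0.
Qed.

Lemma supconv_ge0 a W f Y : 0 < a -> supconv a K W f Y ->
  (forall y, K y -> `|W y| <= C) -> - C - a * N%:R * R0 ^+ 2 <= f 0.
Proof.
move=> a0 [KY fE _] WC; rewrite fE lerB //.
  by have := WC _ (KY 0); rewrite ler_norml => /andP[].
rewrite sub0r dotNl dotNr opprK -mulrA ler_wpM2l ?(ltW a0) //.
apply: le_trans (dotxx_le _) _; rewrite ler_wpM2l // ler_pXn2r ?nnegrE //; exact: KR0.
Qed.

(** Far from [K] both sup-convolutions decay quadratically and so beat any slope in the unit ball; a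
    maximum over a large ball is therefore global, with a radius uniform in [p]. *)
Lemma contact_exists a W W' f g Y Y' : 0 < a ->
  supconv a K W f Y -> supconv a K W' g Y' ->
  (forall y, K y -> `|W y| <= C) -> (forall y, K y -> `|W' y| <= C) ->
  exists2 R1, 0 <= R1 & forall p, `|p| <= 1 ->
    exists2 x, `|x| <= R1 & forall y, f y + g y <= f x + g x + dot p (y - x).
Proof.
move=> a0 fW gW WC WC'.
(* [M] collects the bounds at the origin and the part [N * R0] of the linear term; beyond distance
   [k] from the ball of radius [R0] the decay exceeds [M] and the linear growth together. *)
pose M := 4 * C + 2 * a * N%:R * R0 ^+ 2 + N%:R * R0.
have a0' := ltW a0.
have M0 : 0 <= M by rewrite /M !(addr_ge0, mulr_ge0, exprn_ge0).
pose k := (N%:R + M + 1) / (2 * a) + 1.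
have N0 : 0 <= N%:R :> R by [].
have k1 : 1 <= k by rewrite lerDr; apply: divr_ge0; lra.
have ak : N%:R + M + 1 <= 2 * a * k.
  rewrite /k mulrDr mulr1 mulrC divfK ?lt0r_neq0 ?mulr_gt0 // lerDl mulr_ge0 // ltW.
exists (R0 + k); first by rewrite addr_ge0 // (le_trans _ k1).
move=> p p1; pose h x := f x + g x + (- quad 0 p 0 x).
have qE x : quad 0 p 0 x = dot p x by rewrite /quad mulmx0 dot0l mulr0 add0r addr0.
have [||x xR mx] := @upcalm_ball_max R N h (R0 + k).
- by rewrite addr_ge0 // (le_trans _ k1).
- apply: upcalmD; last by apply: upcalm_quad; rewrite trmx0.
  by apply: upcalmD; apply: supconv_upcalm a0 _ _ KR0 R00; eassumption.
exists x => // y; suff : h y <= h x by rewrite /h !qE dotDr dotNr; lra.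
have [yR|yR] := leP `|y| (R0 + k); first exact: mx.
have R0y : R0 <= `|y| by move: yR k1; lra.
have h0 : h 0 <= h x by apply: mx; rewrite normr0 addr_ge0 // (le_trans _ k1).
apply: le_trans h0; rewrite /h !qE dot0r.
have b1 := supconv_le a0 fW WC R0y; have b2 := supconv_le a0 gW WC' R0y.
have b3 := supconv_ge0 a0 fW WC; have b4 := supconv_ge0 a0 gW WC'.
have b5 := dot_le p y.
have b6 : N%:R * (`|p| * `|y|) <= N%:R * `|y| by rewrite ler_wpM2l // ler_piMl.
move: b5; rewrite ler_norml => /andP[b5 _].
have kk : k <= `|y| - R0 by lra.
have yE : N%:R * `|y| = N%:R * R0 + N%:R * (`|y| - R0) by ring.
move: b1 b2 kk yE b5 b6; move: (`|y| - R0) (N%:R * `|y|) => k' ny b1 b2 kk yE b5 b6.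
have q1 : (N%:R + M + 1) * k' <= 2 * a * k' ^+ 2.
  rewrite expr2 (mulrA _ k') ler_wpM2r //; first by lra.
  by apply: le_trans ak _; rewrite ler_wpM2l // mulr_ge0 // ltW.
have q2 : M <= M * k' by rewrite ler_peMr //; lra.
have q3 : (N%:R + M + 1) * k' = N%:R * k' + M * k' + k' by ring.
have q4 : 4 * C + 2 * a * N%:R * R0 ^+ 2 + N%:R * R0 = M by [].
have q5 : 2 * a * N%:R * R0 ^+ 2 = 2 * (a * N%:R * R0 ^+ 2) by ring.
have q6 : 2 * a * k' ^+ 2 = 2 * (a * k' ^+ 2) by ring.
clearbody M; lra.
Qed.

End Jets.

(** Counterpart of the Crandall-Ishii lemma: a strong penalty brings the two points together, and
    the second-order condition at a maximum of the tilted sum bounds the Hessians. Contact is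
    relative to [K], since the points may still lie on the boundary. *)
Lemma close_jets (R : realType) (N : nat) (K : set 'rV[R]_N) (W W' : 'rV[R]_N -> R)
    (x0 : 'rV[R]_N) (C R0 th0 r : R) :
  compact K -> usc_on K W -> usc_on K W' -> 0 <= C ->
  (forall y, K y -> `|W y| <= C) -> (forall y, K y -> `|W' y| <= C) ->
  (forall y, K y -> `|y| <= R0) -> K x0 -> 0 < th0 -> 2 * th0 <= W x0 + W' x0 -> 0 < r ->
  exists y1 y2 p1 p2 (X1 X2 : 'M[R]_N),
  [/\ K y1 /\ K y2, `|y1 - y2| < r /\ th0 <= W y1 + W' y2, X1^T = X1 /\ X2^T = X2,
    forall xi, dot (xi *m (X1 + X2)) xi <= r * dot xi xi &
    (\forall y \near y1, K y ->
       W y <= W y1 + dot p1 (y - y1) + 2^-1 * dot ((y - y1) *m X1) (y - y1)) /\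
    (\forall y \near y2, K y ->
       W' y <= W' y2 + dot p2 (y - y2) + 2^-1 * dot ((y - y2) *m X2) (y - y2))].
Proof.
move=> cK uW uW' C0 WC WC' KR0 Kx0 th00 Wx0 r0.
have R00 : 0 <= R0 by exact: le_trans (KR0 _ Kx0).
have K0 : K !=set0 by exists x0.
(* The penalties at the chosen maximisers are at most [2 * C], so this [a] keeps the points within
   [r / 4]. *)
pose a := 32 * C / r ^+ 2 + 1.
have a0 : 0 < a by rewrite ltr_wpDl // divr_ge0 ?mulr_ge0 ?exprn_ge0 // ltW.
have ar : 2 * C < a * (r / 4) ^+ 2.
  have -> : a * (r / 4) ^+ 2 = 2 * C + (r / 4) ^+ 2.
    by rewrite /a; field; rewrite lt0r_neq0.
  by rewrite ltrDl exprn_gt0 // divr_gt0.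
clearbody a.
have [f [Y fW]] := supconv_exists a cK K0 uW.
have [g [Y' gW]] := supconv_exists a cK K0 uW'.
have [R1 R10 cont] := contact_exists KR0 R00 C0 a0 fW gW WC WC'.
(* The tilt then costs at most [th0 / 2]; [s1] below limits the loss in moving from [c] to [x1] and
   to [x2] to [th0 / 4] each, out of the initial [2 * th0]. *)
pose rho := Num.min 1 (th0 / (2 * (N%:R * (R0 + R1) + 1))).
have D0 : 0 < 2 * (N%:R * (R0 + R1) + 1) by rewrite mulr_gt0 // ltr_wpDl // mulr_ge0 // addr_ge0.
have rho0 : 0 < rho by rewrite lt_min ltr01 divr_gt0.
have rhoN : 2 * (N%:R * (rho * (R0 + R1))) <= th0.
  have : rho <= th0 / (2 * (N%:R * (R0 + R1) + 1)) by rewrite ge_min lexx orbT.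
  rewrite ler_pdivlMr //; have := rho0; move: (N%:R : R) => n; nra.
pose Ls := N%:R * (2 * a * (R0 + R1) + a).
have a0' := ltW a0.
have Ls0 : 0 <= Ls by rewrite /Ls !(addr_ge0, mulr_ge0).
pose s1 := Num.min (Num.min 1 (r / 4)) (th0 / (4 * (Ls + 1))).
have Ls1 : 0 < 4 * (Ls + 1) by rewrite mulr_gt0 // ltr_wpDl.
have s10 : 0 < s1 by rewrite !lt_min ltr01 !divr_gt0.
have sf := supconv_lower_support fW; have sg := supconv_lower_support gW.
(* Four expansions with error [r / 12] contribute [r / 3], and each of [X1] and [X2] adds
   [4 * (r / 12)]; the total is [r]. *)
have th : 0 < r / 12 by rewrite divr_gt0.
have [|c [p [H [A1 [A2 [cR pr /andP[H0 Hs1] hc exp]]]]]] :=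
  @approx_second_order R N f g _ _ a rho R1 a0 rho0 sf sg _ (r / 12) s1 th s10.
  by move=> p pr; apply: cont; apply: le_trans pr _; rewrite ge_min lexx.
have [H1 Hr Hth] : [/\ H <= 1, H <= r / 4 & 4 * (Ls * H) <= th0].
  move: Hs1; rewrite !le_min => /andP[/andP[-> ->]]; rewrite ler_pdivlMr // => h; split=> //.
  by move: h H0; nra.
have cf : upcalm f := supconv_upcalm a0 fW KR0 R00.
have cg : upcalm g := supconv_upcalm a0 gW KR0 R00.
have [|x1 [p1 [x1c t1]]] := @touch_of_approx R N f c (supconv_grad a Y c) A1 H (r / 12) cf H0 th.
  by move=> d /exp[+ _]; rewrite ler_norml => /andP[].
have [|x2 [p2 [x2c t2]]] := @touch_of_approx R N g c (supconv_grad a Y' c) A2 H (r / 12) cg H0 th.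
  by move=> d /exp[_]; rewrite ler_norml => /andP[].
set X1 := _ + _ in t1; set X2 := _ + _ in t2.
have [KY fE fge] := fW; have [KY' gE gge] := gW.
have vf : f c - th0 / 4 <= f x1.
  have := supconv_loss a0 fW KR0 cR (le_trans (ltW x1c) H1); rewrite (addrC c) subrK -/Ls.
  have : Ls * `|x1 - c| <= Ls * H by rewrite ler_wpM2l // ltW.
  lra.
have vg : g c - th0 / 4 <= g x2.
  have := supconv_loss a0 gW KR0 cR (le_trans (ltW x2c) H1); rewrite (addrC c) subrK -/Ls.
  have : Ls * `|x2 - c| <= Ls * H by rewrite ler_wpM2l // ltW.
  lra.
have vx0 : W x0 + W' x0 <= f x0 + g x0.
  have := fge x0 x0 Kx0; have := gge x0 x0 Kx0; rewrite subrr dot0l; lra.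
have vc := hc x0.
have vp : `|dot p (x0 - c)| <= N%:R * (rho * (R0 + R1)).
  apply: le_trans (dot_le _ _) _; rewrite ler_wpM2l // ler_pM //.
  by apply: le_trans (ler_normB _ _) _; rewrite lerD // KR0.
have sum : th0 <= f x1 + g x2.
  move: vp; rewrite ler_norml => /andP[_ vp]; lra.
have d1 := dotxx_ge0 (x1 - Y x1); have d2 := dotxx_ge0 (x2 - Y' x2).
have ad1 : 0 <= a * dot (x1 - Y x1) (x1 - Y x1) by rewrite mulr_ge0 // ltW.
have ad2 : 0 <= a * dot (x2 - Y' x2) (x2 - Y' x2) by rewrite mulr_ge0 // ltW.
have := WC _ (KY x1); have := WC' _ (KY' x2); rewrite !ler_norml => /andP[_ w2] /andP[_ w1].
move: (sum); rewrite (fE x1) (gE x2) => sum'.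
have near_pt (x y : 'rV[R]_N) : a * dot (x - y) (x - y) <= 2 * C -> `|x - y| < r / 4.
  move=> h; rewrite ltNge; apply/negP => h'.
  have : (r / 4) ^+ 2 <= dot (x - y) (x - y).
    by apply: le_trans (sqr_norm_le_dot _); rewrite ler_pXn2r ?nnegrE // divr_ge0 // ltW.
  move/(ler_wpM2l (ltW a0)); lra.
have n1 : `|x1 - Y x1| < r / 4 by apply: near_pt; lra.
have n2 : `|x2 - Y' x2| < r / 4 by apply: near_pt; lra.
exists (Y x1), (Y' x2), p1, p2, X1, X2; split.
- by split.
- split; last by lra.
  have -> : Y x1 - Y' x2 = - (x1 - Y x1) + (x1 - c) - (x2 - c) + (x2 - Y' x2).
    by apply/rowP => i; rewrite !mxE; ring.
  apply: le_lt_trans (ler_normD _ _) _.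
  have := ler_normB (- (x1 - Y x1) + (x1 - c)) (x2 - c).
  have := ler_normD (- (x1 - Y x1)) (x1 - c); rewrite normrN; lra.
- by split; rewrite /X1 /X2 linearD linearZ /= linearD /= trmxK tr_scalar_mx (addrC (_^T)).
- move=> xi.
  (* Adding the expansions at [d] and [- d] cancels the gradients, and [hc] at both points bounds
     the second difference of [f + g]. *)
  have qle d : `|d| <= H -> dot (d *m A1) d + dot (d *m A2) d <= r / 3 * H ^+ 2.
    move=> dH; have [e1 e2] := exp d dH; have [|e3 e4] := exp (- d); first by rewrite normrN.
    have i1 := hc (c + d); have i2 := hc (c - d).
    move: e1 e2 e3 e4 i1 i2; rewrite (addrC c d) (addrC c (- d)) !addrK !ler_norml.
    rewrite !mulNmx !dotNr !dotNl !opprK.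
    move: (H ^+ 2) => h2 /andP[? _] /andP[? _] /andP[? _] /andP[? _] ? ?; lra.
  have XE (A : 'M[R]_N) : dot (xi *m (2^-1 *: (A + A^T) + (4 * (r / 12))%:M)) xi
      = dot (xi *m A) xi + r / 3 * dot xi xi.
    rewrite mulmxDr -scalemxAr mulmxDr mul_mx_scalar !dotDl !dotZl dotDl (dot_trmx A^T) trmxK.
    by field.
  rewrite mulmxDr dotDl /X1 /X2 !XE.
  have [->|xi0] := eqVneq xi 0; first by rewrite !mul0mx !dot0l; lra.
  have nx : 0 < `|xi| by rewrite normr_gt0.
  have := qle ((H / `|xi|) *: xi); rewrite normrZ ger0_norm ?divr_ge0 ?(ltW H0) // divfK ?lt0r_neq0 //.
  rewrite lexx => /(_ isT); rewrite -!scalemxAl !dotZl !dotZr.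
  have := sqr_norm_le_dot xi.
  have -> : forall u v : R, H / `|xi| * (H / `|xi| * u) + H / `|xi| * (H / `|xi| * v) =
     (u + v) / `|xi| ^+ 2 * H ^+ 2 by move=> u v; field; rewrite lt0r_neq0.
  rewrite ler_pM2r ?exprn_gt0 // ler_pdivrMr ?exprn_gt0 // => h1 h2.
  have : r / 3 * `|xi| ^+ 2 <= r / 3 * dot xi xi by rewrite ler_wpM2l // divr_ge0 // ltW.
  lra.
- by split; [have := supconv_touch fW t1 | have := supconv_touch gW t2].
Qed.
(** * Jets and the comparison principle *)

Lemma maxabseigN (R : realType) (N : nat) (E : 'M[R]_N) : maxabseig (- E) = maxabseig E.
Proof.
have sub (A : 'M[R]_N) a : eigenvalue A a -> eigenvalue (- A) (- a).
  move=> /eigenvalueP[v vA v0]; apply/eigenvalueP; exists v => //.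
  by rewrite mulmxN vA scaleNr.
rewrite /maxabseig; congr sup; apply/seteqP; split=> _ [a ea <-]; exists (- a); rewrite ?normrN //.
  by rewrite -(opprK E); exact: sub.
exact: sub.
Qed.

Section JetSets.
Variables (R : realType) (N : nat).
Local Notation V := 'rV[R]_N.
Implicit Types (Phi Psi : set (R * 'M[R]_N)) (A : 'M[R]_N).

Lemma jdist_lt (p q : R * 'M[R]_N) e : jetspace p -> jetspace q -> jdist p q < e ->
  [/\ `|p.1 - q.1| < e,
    forall xi : V, dot (xi *m q.2) xi <= dot (xi *m p.2) xi + e * dot xi xi &
    forall xi : V, dot (xi *m p.2) xi <= dot (xi *m q.2) xi + e * dot xi xi].
Proof.
rewrite /jetspace /Defs.symmetric /= => sp sq; rewrite /jdist /jnorm gt_max /= => /andP[h1 h2].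
have sE : (p.2 - q.2)^T = p.2 - q.2 by rewrite linearB /= sp sq.
split=> // xi; have d0 := dotxx_ge0 xi.
  have := @rayleigh_le_maxabseig R N (- (p.2 - q.2)) xi; rewrite maxabseigN linearN /= sE => /(_ erefl).
  rewrite mulmxN mulmxBr !dotE; have := ler_wpM2r d0 (ltW h2); lra.
have := @rayleigh_le_maxabseig R N (p.2 - q.2) xi sE.
rewrite mulmxBr !dotE; have := ler_wpM2r d0 (ltW h2); lra.
Qed.

Definition elliptic_set Phi := Phi `<=` @jetspace R N /\ jsum Phi (@Qcone R N) `<=` Phi.

Lemma elliptic_mono Phi r r' A A' : elliptic_set Phi -> Phi (r, A) -> r' <= r ->
  A'^T = A' -> (forall xi : V, dot (xi *m A) xi <= dot (xi *m A') xi) -> Phi (r', A').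
Proof.
move=> [sPhi ell] PA rr sA' AA'; apply: ell; exists (r, A) => //.
have sA : A^T = A := sPhi _ PA.
exists (r' - r, A' - A); last by rewrite /= !(addrC r) !(addrC A) !subrK.
split; rewrite /= ?subr_le0 //; split; first by rewrite /Defs.symmetric linearB /= sA sA'.
by move=> xi; rewrite -dot_mx mulmxBr !dotE subr_ge0.
Qed.

(** Nearby jets differ by less than [eta] in value and in quadratic form, so a shift by [eta] in the
    direction of [Qcone] absorbs the discrepancy. *)
Lemma hausdorff_sub Phi Psi (eta : R) : (hausdorff Phi Psi < eta%:E)%E ->
  elliptic_set Phi -> elliptic_set Psi ->
  forall r A, (Phi (r, A) -> Psi (r - eta, A + eta%:M)) /\
              (Psi (r, A) -> Phi (r - eta, A + eta%:M)).
Proof.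
move=> /ereal_inf_lt[_ [e [e0 [s1 s2]] <-]]; rewrite lte_fin => ee eP eQ r A.
have aux P Q : elliptic_set P -> elliptic_set Q -> P `<=` jnbhd e Q ->
    P (r, A) -> Q (r - eta, A + eta%:M).
  move=> [sP _] eQ' sub PA; have [_ [[r' A'] QA /= dist]] := sub _ PA.
  have [h1 h2 _] := jdist_lt (sP _ PA) (eQ'.1 _ QA) dist.
  have sA : A^T = A := sP _ PA.
  apply: elliptic_mono eQ' QA _ _ _; first by move: h1; rewrite /= ltr_norml => /andP[]; lra.
    by rewrite linearD /= sA tr_scalar_mx.
  move=> xi; have := h2 xi; rewrite /= mulmxDr mul_mx_scalar !dotE.
  have := ler_wpM2r (dotxx_ge0 xi) (ltW ee); lra.
by split; exact: aux.
Qed.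

(** Every jet within [e] of [(r, A)] lies above [(r + e, A - e%:M)] in the elliptic order. *)
Lemma elliptic_interior Phi r A e : elliptic_set Phi -> Phi (r + e, A - e%:M) ->
  0 < e -> A^T = A -> jinterior Phi (r, A).
Proof.
move=> eP PA e0 sA; split=> //; exists e => // -[r' A'] sA' dist.
have [h1 _ h2] := jdist_lt (sA : jetspace (r, A)) sA' dist.
apply: elliptic_mono eP PA _ sA' _.
  by move: h1; rewrite /= ltr_norml => /andP[]; lra.
by move=> xi; have := h2 xi; rewrite /= mulmxBr mul_mx_scalar !dotE; lra.
Qed.

Lemma quad_center c (p y : V) X x : X^T = X ->
  c + dot p (x - y) + 2^-1 * dot ((x - y) *m X) (x - y) =
  quad (c - dot p y + 2^-1 * dot (y *m X) y) (p - y *m X) X x.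
Proof.
move=> sX; rewrite /quad mulmxBl !dotE (dot_trmx X x y) sX; by field.
Qed.

End JetSets.

(** * Real-valued truncations of semicontinuous functions *)

Section Truncation.
Variables (R : realType) (N : nat).
Local Notation V := 'rV[R]_N.

(** Real-valued form of the maximum of [u] and [- C]; the default gives [- C] at [+oo] too, a value
    that upper semicontinuous functions do not take. *)
Definition trunc_below (C : R) (u : V -> \bar R) x : R :=
  if u x is r%:E then Num.max r (- C) else - C.

Lemma trunc_below_geN C u x : - C <= trunc_below C u x.
Proof. by rewrite /trunc_below; case: (u x) => [r||] //; rewrite le_max lexx orbT. Qed.

Lemma le_trunc_below C u x : u x != +oo%E -> (u x <= (trunc_below C u x)%:E)%E.
Proof.
rewrite /trunc_below; case: (u x) => [r||] // _; last by rewrite leNye.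
by rewrite lee_fin le_max lexx.
Qed.

Lemma trunc_below_eq C u x : - C < trunc_below C u x -> u x = (trunc_below C u x)%:E.
Proof.
rewrite /trunc_below; case: (u x) => [r||]; rewrite ?ltxx // lt_max ltxx orbF => Cr.
by rewrite max_l // ltW.
Qed.

Lemma trunc_below_le C u x t : (u x <= t%:E)%E -> - C <= t -> trunc_below C u x <= t.
Proof.
rewrite /trunc_below; case: (u x) => [r||] //.
by rewrite lee_fin ge_max => -> ->.
Qed.

Lemma trunc_below_lt C u x t : (u x < t%:E)%E -> - C < t -> trunc_below C u x < t.
Proof.
rewrite /trunc_below; case: (u x) => [r||] //.
by rewrite lte_fin gt_max => -> ->.
Qed.

Lemma trunc_below_usc (K : set V) C u : USC K u -> usc_on K (trunc_below C u).
Proof.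
move=> uK x Kx t xt; have Ct : - C < t := le_lt_trans (trunc_below_geN C u x) xt.
have [ux near_t] := uK x Kx.
have /near_t : (u x < t%:E)%E.
  by apply: le_lt_trans (le_trunc_below C ux) _; rewrite lte_fin.
by apply: filterS => y h Ky; apply: trunc_below_lt => //; exact: h.
Qed.

Lemma USC_bounded (K : set V) (u : V -> \bar R) : compact K -> K !=set0 -> USC K u ->
  exists2 C : R, 0 <= C & forall x, K x -> (u x <= C%:E)%E.
Proof.
move=> cK K0 uK.
have [|x Kx mx] := @usc_compact_max _ _ _ K u cK K0.
  move=> z x Kz Kx; have [ux _] := uK x Kx; have [_ near_z] := uK z Kz.
  case: (u x) ux => [r _|//|_]; last by rewrite ltNge leNye.
  exact: near_z.
exists `|fine (u x)| => // y Ky; apply: le_trans (mx y Ky) _.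
have [ux _] := uK x Kx; case: (u x) ux => [r _|//|_] /=; last by rewrite leNye.
by rewrite lee_fin ler_norm.
Qed.

Lemma LSC_opp (K : set V) (v : V -> \bar R) : LSC K v -> USC K (fun x => - v x)%E.
Proof.
move=> vK x Kx; have [vx near_x] := vK x Kx; split.
  by apply: contra vx => /eqP h; rewrite -(oppeK (v x)) h.
move=> t; rewrite lteNl -EFinN => /near_x; apply: filterS => y h Ky.
by rewrite lteNl -EFinN; exact: h.
Qed.

End Truncation.

Lemma closure_bounded (R : realType) (N : nat) (Om : set 'rV[R]_N) : bounded_set Om ->
  exists2 R0 : R, 0 <= R0 & forall x, closure Om x -> `|x| <= R0.
Proof.
move=> [M [_ hM]]; exists (`|M| + 1); first exact: addr_ge0.
have Mlt : M < `|M| + 1 by have := ler_norm M; lra.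
have cl : closed [set x : 'rV[R]_N | `|x| <= `|M| + 1].
  apply: (@closed_comp _ _ (fun x : 'rV[R]_N => `|x|) [set y | y <= `|M| + 1]); last exact: closed_le.
  by move=> x _; exact: norm_continuous.
move=> x cx; have : closure [set x : 'rV[R]_N | `|x| <= `|M| + 1] x.
  by apply: closure_subset cx => y Oy; exact: (hM _ Mlt).
by rewrite -(closure_id _).1.
Qed.

(** Bridges the max norm of the topology and the Euclidean norm in [hausdorff_continuous]. *)
Lemma euclid_lt (R : realType) (N : nat) (x : 'rV[R]_N) (e : R) : 0 < e ->
  `|x| * (N%:R + 1) < e -> euclid x < e.
Proof.
move=> e0 xe; rewrite -(ger0_norm (ltW e0)) -sqrtr_sqr ltr_sqrt ?exprn_gt0 //.
have -> : \sum_(i < N) x ord0 i ^+ 2 = dot x x by apply: eq_bigr => i _; rewrite expr2.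
apply: le_lt_trans (dotxx_le x) _.
apply: (@le_lt_trans _ _ ((`|x| * (N%:R + 1)) ^+ 2)).
  have := normr_ge0 x; have : 0 <= N%:R :> R by [].
  move: `|x| (N%:R : R) => a n; nra.
by rewrite ltr_pXn2r ?nnegrE ?mulr_ge0 ?addr_ge0 // ltW.
Qed.

(** * Test jets of the original functions *)

Section TestJets.
Variables (R : realType) (N : nat).
Local Notation V := 'rV[R]_N.

(** Moves the perturbation [kap * (dot y y - Bq)] from [u] to the test quadratic, which accounts for
    the shift of the jet. *)
Lemma upper_jet_of_touch (u : V -> \bar R) C kap Bq (p y0 : V) (X : 'M[R]_N) :
  let W y := trunc_below C u y + kap * (dot y y - Bq) in
  X^T = X -> (\forall y \near y0, u y != +oo%E) -> - C < trunc_below C u y0 ->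
  (\forall y \near y0, W y <= W y0 + dot p (y - y0) + 2^-1 * dot ((y - y0) *m X) (y - y0)) ->
  upper_jets u y0 (W y0 + kap * (Bq - dot y0 y0), X - (2 * kap)%:M).
Proof.
move=> W sX fin Cu touch.
pose q := quad (W y0 - dot p y0 + 2^-1 * dot (y0 *m X) y0 + kap * Bq) (p - y0 *m X)
  (X - (2 * kap)%:M).
have sX' : (X - (2 * kap)%:M)^T = X - (2 * kap)%:M by rewrite linearB /= sX tr_scalar_mx.
have qE y : q y = W y0 + dot p (y - y0) + 2^-1 * dot ((y - y0) *m X) (y - y0)
    - kap * (dot y y - Bq).
  by rewrite quad_center // /q /quad mulmxBr mul_mx_scalar !dotE; field.
have qy0 : q y0 = W y0 + kap * (Bq - dot y0 y0).
  by rewrite qE subrr mul0mx !dotE; ring.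
exists q; split.
- exact: C2_quad.
- move: fin touch; apply: filterS2 => y uy h.
  apply: le_trans (le_trunc_below C uy) _; rewrite lee_fin qE; move: h; rewrite {1}/W; lra.
- by rewrite (trunc_below_eq Cu) qy0 /W; congr EFin; ring.
- by rewrite hessian_quad // qy0.
Qed.

Lemma lower_jet_of_touch (v : V -> \bar R) C (p y0 : V) (X : 'M[R]_N) :
  let W := trunc_below C (fun y => - v y)%E in
  X^T = X -> (\forall y \near y0, (- v y)%E != +oo%E) -> - C < W y0 ->
  (\forall y \near y0, W y <= W y0 + dot p (y - y0) + 2^-1 * dot ((y - y0) *m X) (y - y0)) ->
  lower_jets v y0 (- W y0, - X).
Proof.
move=> W sX fin Cu touch.
pose q := quad (- (W y0 - dot p y0 + 2^-1 * dot (y0 *m X) y0)) (- (p - y0 *m X)) (- X).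
have sX' : (- X)^T = - X by rewrite linearN /= sX.
have qE y : q y = - (W y0 + dot p (y - y0) + 2^-1 * dot ((y - y0) *m X) (y - y0)).
  by rewrite quad_center // /q /quad mulmxN !dotE; ring.
have qy0 : q y0 = - W y0 by rewrite qE subrr mul0mx !dotE; ring.
exists q; split.
- exact: C2_quad.
- move: fin touch; apply: filterS2 => y vy h.
  apply: (@le_trans _ _ (- (W y)%:E)%E); first by rewrite -EFinN lee_fin qE lerN2.
  by rewrite leeNl; exact: (@le_trunc_below _ _ C (fun y => - v y)%E).
- by rewrite qy0 EFinN /W -(trunc_below_eq Cu) oppeK.
- by rewrite hessian_quad // qy0.
Qed.

End TestJets.

Lemma proper_elliptic_set (R : realType) (N : nat) (Omega : set 'rV[R]_N) Theta x :
  proper_elliptic_map Omega Theta -> Omega x -> elliptic_set (Theta x).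
Proof. by move=> pe Ox; have [[sT _] _ _ ell] := pe x Ox. Qed.

(* The membership of [(a, X1)] in [Theta y1] has a margin of order [kap], half of
   which is spent on the two Hausdorff steps from [y1] to [z] and from [z] to [y2]. *)
Lemma jets_incompatible (R : realType) (N : nat) (Omega : set 'rV[R]_N)
    (Theta : 'rV[R]_N -> set (R * 'M[R]_N)%type) (z y1 y2 : 'rV[R]_N) (a b kap : R)
    (X1 X2 : 'M[R]_N) :
  proper_elliptic_map Omega Theta -> Omega z -> Omega y1 -> Omega y2 -> 0 < kap ->
  (hausdorff (Theta z) (Theta y1) < (kap / 4)%:E)%E ->
  (hausdorff (Theta z) (Theta y2) < (kap / 4)%:E)%E ->
  X1^T = X1 -> X2^T = X2 ->
  (forall xi, dot (xi *m (X1 + X2)) xi <= kap / 2 * dot xi xi) -> b <= a ->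
  Theta y1 (a + kap, X1 - (2 * kap)%:M) -> jinterior (Theta y2) (b, - X2).
Proof.
move=> pe Oz O1 O2 kap0 hz1 hz2 s1 s2 X12 ba T1.
have e0 := proper_elliptic_set pe Oz; have e1 := proper_elliptic_set pe O1.
have e2 := proper_elliptic_set pe O2.
have Tz := (hausdorff_sub hz1 e0 e1 _ _).2 T1.
have T2 := (hausdorff_sub hz2 e0 e2 _ _).1 Tz.
apply: (@elliptic_interior _ _ _ _ _ (kap / 2)) => //; last by rewrite linearN /= s2.
- apply: elliptic_mono e2 T2 _ _ _; first by lra.
    by rewrite linearB linearN /= s2 tr_scalar_mx.
  move=> xi; have := X12 xi; have := dotxx_ge0 xi.
  rewrite !mulmxDr !mulmxN !mul_mx_scalar !dotE.
  move: (dot xi xi) (dot (xi *m X1) xi) (dot (xi *m X2) xi) => *; nra.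
- by rewrite divr_gt0.
Qed.

Theorem theorem5p1 (R : realType) (N : nat) (Omega : set 'rV[R]_N)
  (Theta : 'rV[R]_N -> set (R * 'M[R]_N)%type) (u v : 'rV[R]_N -> \bar R) :
  open Omega -> bounded_set Omega -> connected Omega ->
  proper_elliptic_map Omega Theta -> hausdorff_continuous Omega Theta ->
  USC (closure Omega) u -> subharmonic Theta Omega u ->
  LSC (closure Omega) v -> superharmonic Theta Omega v ->
  (forall x, (closure Omega `\` Omega) x -> (u x <= v x)%E) ->
  forall x, Omega x -> (u x <= v x)%E.
Proof.
move=> oO bO _ pe hcont uK [_ usub] vK [_ vsup] bdry x Ox.
rewrite leNgt; apply/negP => vu.
pose K := closure Omega.
have KO y : Omega y -> K y := @subset_closure _ Omega y.
have [R0 R00 KR0] := closure_bounded bO.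
have cK : compact K.
  apply: bounded_closed_compact; last exact: closed_closure.
  by exists R0; split=> [|M RM y Ky]; [exact: num_real | exact: le_trans (KR0 y Ky) (ltW RM)].
have Kx := KO x Ox; have K0 : K !=set0 by exists x.
have wK := LSC_opp vK; pose w y := (- v y)%E.
have [C1 C10 uC1] := USC_bounded cK K0 uK; have [C2 C20 wC2] := USC_bounded cK K0 wK.
pose C := C1 + C2; have C0 : 0 <= C by exact: addr_ge0.
have uC y : K y -> (u y <= C%:E)%E.
  by move=> Ky; apply: le_trans (uC1 y Ky) _; rewrite lee_fin lerDl.
have wC y : K y -> (w y <= C%:E)%E.
  by move=> Ky; apply: le_trans (wC2 y Ky) _; rewrite lee_fin lerDr.
have finu y : K y -> u y != +oo%E by move=> /uK[].
have finw y : K y -> w y != +oo%E by move=> /wK[].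
pose U := trunc_below C u; pose W' := trunc_below C w.
have uU y : K y -> (u y <= (U y)%:E)%E by move=> Ky; apply: le_trunc_below; exact: finu.
have wW' y : K y -> (w y <= (W' y)%:E)%E by move=> Ky; apply: le_trunc_below; exact: finw.
have [UC W'C] : (forall y, K y -> - C <= U y <= C) /\ (forall y, K y -> - C <= W' y <= C).
  by split=> y Ky; rewrite trunc_below_geN /=; apply: trunc_below_le; rewrite ?uC ?wC //; lra.
have D0 : 0 < U x + W' x.
  have h1 := uU x Kx; have h2 := wW' x Kx.
  have h3 : (- (W' x)%:E <= v x)%E by rewrite leeNl.
  by rewrite -lte_fin EFinD -lteBlDr // sub0e; apply: le_lt_trans h3 (lt_le_trans vu h1).
set D := U x + W' x in D0.
(* [Bq] exceeds [dot y y] on [K] by at least [1], so the perturbation lowers [u] there by at least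
   [kap]; it lowers it by at most [kap * Bq = D / 2]. *)
pose Bq := N%:R * R0 ^+ 2 + 1.
have Bq0 : 0 < Bq by rewrite ltr_wpDl // mulr_ge0 // exprn_ge0.
have KBq y : K y -> dot y y + 1 <= Bq.
  move=> Ky; rewrite lerD2r; apply: le_trans (dotxx_le y) _; rewrite ler_wpM2l //.
  by rewrite ler_pXn2r ?nnegrE //; exact: KR0.
pose kap := D / (2 * Bq).
have kap0 : 0 < kap by rewrite divr_gt0 // mulr_gt0.
have kapB : 2 * (kap * Bq) = D by rewrite /kap; field; exact: lt0r_neq0.
pose W y := U y + kap * (dot y y - Bq).
have Wle y : K y -> W y <= U y - kap.
  by move=> Ky; have := ler_wpM2l (ltW kap0) (KBq y Ky); rewrite /W mulrDr mulr1 mulrBr; lra.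
have Wge y : U y - kap * Bq <= W y.
  by rewrite /W mulrBr; have := mulr_ge0 (ltW kap0) (dotxx_ge0 y); lra.
have uscW' : usc_on K W' := trunc_below_usc wK.
have uscW : usc_on K W.
  have sS : (- (2 * kap)%:M : 'M[R]_N)^T = - (2 * kap)%:M by rewrite linearN /= tr_scalar_mx.
  have -> : W = fun y => U y + - quad (kap * Bq) 0 (- (2 * kap)%:M) y.
    apply/funext => y; rewrite /W /quad mulmxN mul_mx_scalar !dotE.
    by field.
  by apply: usc_onD; [exact: trunc_below_usc | exact: upcalm_quad].
pose C' := C + kap * Bq.
have kB0 : 0 < kap * Bq by rewrite mulr_gt0.
have WC y : K y -> `|W y| <= C'.
  move=> Ky; have := Wle y Ky; have := Wge y; have /andP[? ?] := UC y Ky.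
  by rewrite ler_norml /C' => ? ?; apply/andP; split; lra.
have W'C' y : K y -> `|W' y| <= C'.
  move=> Ky; have /andP[? ?] := W'C y Ky.
  by rewrite ler_norml /C'; apply/andP; split; lra.
pose th0 := D / 4; have th00 : 0 < th0 by rewrite divr_gt0.
have Wx : 2 * th0 <= W x + W' x by rewrite /th0; have := Wge x; move: kapB; rewrite /D; lra.
have C'0 : 0 <= C' by rewrite addr_ge0 // ltW.
(* The bound [kap / 2] is for the Hessians; [n.+1%:R^-1] makes both points approach a common cluster
   point. *)
pose r (n : nat) := Num.min (kap / 2) (n.+1%:R^-1) : R.
have r0 n : 0 < r n by rewrite lt_min divr_gt0 //= invr_gt0.
have /choice[y1 hy1] := fun n => close_jets cK uscW uscW' C'0 WC W'C' KR0 Kx th00 Wx (r0 n).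
have [z Kz clz] : exists2 z, K z &
    forall B, nbhs z B -> forall n0, exists2 n, (n0 <= n)%N & B (y1 n).
  by apply: seq_cluster => // n; have [y2 [p1 [p2 [X1 [X2 [[]]]]]]] := hy1 n.
have step (e : R) : 0 < e -> exists n y2 p1 p2 X1 X2,
    [/\ `|y1 n - z| < e /\ `|y2 - z| < e, K (y1 n) /\ K y2,
       th0 <= W (y1 n) + W' y2, X1^T = X1 /\ X2^T = X2 &
    [/\ forall xi, dot (xi *m (X1 + X2)) xi <= kap / 2 * dot xi xi,
    (\forall y \near y1 n, K y ->
       W y <= W (y1 n) + dot p1 (y - y1 n) + 2^-1 * dot ((y - y1 n) *m X1) (y - y1 n)) &
    (\forall y \near y2, K y ->
       W' y <= W' y2 + dot p2 (y - y2) + 2^-1 * dot ((y - y2) *m X2) (y - y2))]].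
  move=> e0; have e20 : 0 < e / 2 by rewrite divr_gt0.
  have zB : nbhs z [set y | `|y - z| < e / 2] by apply/near_norm; exists (e / 2).
  have [n nn /= ny] := clz _ zB (Num.truncn (e / 2)^-1).
  have rn : r n < e / 2.
    apply: le_lt_trans (_ : n.+1%:R^-1 < _); first by rewrite ge_min lexx orbT.
    rewrite invf_plt ?posrE ?ltr0n //; apply: lt_le_trans (truncnS_gt _) _.
    by rewrite ler_nat ltnS.
  have [y2 [p1 [p2 [X1 [X2 [K12 [d12 sum] s12 X12 [t1 t2]]]]]]] := hy1 n.
  exists n, y2, p1, p2, X1, X2; split=> //.
    split; first by lra.
    have := ler_distD (y1 n) y2 z; rewrite (distrC y2 (y1 n)); lra.
  split=> // xi; apply: le_trans (X12 xi) _; rewrite ler_wpM2r ?dotxx_ge0 //.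
  by rewrite ge_min lexx.
(* At a boundary point [u <= v] would make [W z + W' z] nonpositive, while pairs arbitrarily close
   to [z] have sum at least [th0], against upper semicontinuity. *)
have Oz : Omega z.
  apply: contrapT => nOz.
  have Wz : W z + W' z <= 0.
    have /andP[Uge Ule] := UC z Kz.
    (* If [U z] is at the level [- C], then [w z <= C] suffices; otherwise [U z] is the value of [u]
       and the boundary inequality applies. *)
    have : W' z <= - U z.
      apply: trunc_below_le; last by rewrite lerN2.
      rewrite EFinN leeN2; move: Uge; rewrite le_eqVlt => /orP[/eqP <-|/trunc_below_eq <-].
        by rewrite EFinN leeNl; exact: wC.
      exact: bdry.
    have := Wle z Kz; lra.
  have h2 : 0 < th0 / 2 by rewrite divr_gt0.
  have : W z < W z + th0 / 2 by rewrite ltrDl.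
  move=> /(uscW z Kz)/near_norm[e1 e10 h1].
  have : W' z < W' z + th0 / 2 by rewrite ltrDl.
  move=> /(uscW' z Kz)/near_norm[e2 e20 h1'].
  have [|n [y2 [p1 [p2 [X1 [X2 [[d1 d2] [K1 K2] sum _ _]]]]]]] := step (Num.min e1 e2).
    by rewrite lt_min e10.
  move: d1 d2; rewrite !lt_min => /andP[d1 _] /andP[_ d2].
  by have := h1 _ d1 K1; have := h1' _ d2 K2; lra.
have k40 : 0 < kap / 4 by rewrite divr_gt0.
have [de de0 hde] := hcont z Oz (kap / 4) k40.
have /near_norm[e1 e10 O1] : \forall y \near z, Omega y by exact: open_nbhs_nbhs.
have N1 : 0 < N%:R + 1 :> R by rewrite ltr_wpDl.
have [|n [y2 [p1 [p2 [X1 [X2 [[d1 d2] [K1 K2] sum [s1 s2] [X12 t1 t2]]]]]]]] :=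
  step (Num.min e1 (de / (N%:R + 1))); first by rewrite lt_min e10 divr_gt0.
move: d1 d2; rewrite !lt_min !ltr_pdivlMr // => /andP[d1 d1'] /andP[d2 d2'].
have Oy1 := O1 _ d1; have Oy2 := O1 _ d2.
have hz1 : (hausdorff (Theta z) (Theta (y1 n)) < (kap / 4)%:E)%E.
  by apply: hde => //; apply: euclid_lt; rewrite // distrC.
have hz2 : (hausdorff (Theta z) (Theta y2) < (kap / 4)%:E)%E.
  by apply: hde => //; apply: euclid_lt; rewrite // distrC.
have near_in (y : 'rV[R]_N) : Omega y -> \forall y' \near y, Omega y'.
  by move=> Oy; exact: open_nbhs_nbhs.
(* As each truncation is at most [C], the lower bound [th0] on the sum keeps the other above [- C],
   where it agrees with [u] or [- v]. *)
have /andP[U1 U2] := UC _ K1; have /andP[V1 V2] := W'C _ K2; have W1 := Wle _ K1.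
have T1 : Theta (y1 n) (W (y1 n) + kap, X1 - (2 * kap)%:M).
  have : upper_jets u (y1 n) (W (y1 n) + kap * (Bq - dot (y1 n) (y1 n)), X1 - (2 * kap)%:M).
    apply: upper_jet_of_touch s1 _ _ _.
    - by apply: filterS (near_in _ Oy1) => y /KO; exact: finu.
    - by rewrite -/U; lra.
    - by move: (near_in _ Oy1) t1; apply: filterS2 => y /KO Ky; exact.
  move/(usub _ Oy1) => T; apply: elliptic_mono (proper_elliptic_set pe Oy1) T _ _ _ => //.
    by rewrite lerD2l ler_peMr ?(ltW kap0) // lerBrDl; exact: KBq.
  by rewrite linearB /= s1 tr_scalar_mx.
have T2 : lower_jets v y2 (- W' y2, - X2).
  apply: lower_jet_of_touch s2 _ _ _.
  - by apply: filterS (near_in _ Oy2) => y /KO; exact: finw.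
  - by rewrite -/W'; lra.
  - by move: (near_in _ Oy2) t2; apply: filterS2 => y /KO Ky; exact.
(* Positivity of the sum gives [- W' y2 <= W (y1 n)], so the lower jet of [v] lies in the interior
   of [Theta y2]. *)
apply: (vsup _ Oy2 _ T2).
by apply: (jets_incompatible pe Oz Oy1 Oy2 kap0 hz1 hz2 s1 s2 X12 _ T1); lra.
Qed.
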